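(* Consider $N$ agents $\dot{\tilde x}_i=\tilde A\tilde x_i+\tilde B\tilde u_i$, $y_i=\tilde C\tilde x_i$, $i=1,\dots,N$, with $\tilde x_i\in\mathbb{R}^{\kappa}$, $\tilde u_i,y_i\in\mathbb{R}^m$. Suppose that the agent system is minimum-phase and has a vector relative degree $(r_1,\dots,r_m)$; that the communication graph $\mathcal G$ with weights $a_{ij}$ is undirected and connected; and that each local cost $f_i:\mathbb{R}^m\to\mathbb{R}$ is differentiable and strictly convex, $i=1,\dots,N$, and $f=\sum_{i=1}^N f_i$ has a finite minimizer $y^*$. Let $n=\max\{r_1,\dots,r_m\}$ and let $c_0,\dots,c_{n-1}$ be constants such that $\sum_{k=0}^{n-1}c_ks^k+s^n$ is Hurwitz. Then for any $\varepsilon>0$ the optimal output consensus problem for these agents is solved by the control $$\begin{cases}\tilde u_i=\tilde R^{-1}(-\Upsilon\chi_i^a-S\chi_i^b+u_i),\\ v_i=-\frac{1}{\varepsilon^n}\big[c_0(y_i-z_i)+\sum_{k=1}^{n-1}\varepsilon^kc_ky_i^{(k)}\big],\\ \dot z_i=-\nabla f_i(z_i)-\sum_{j=1}^Na_{ij}(\lambda_i-\lambda_j),\\ \dot\lambda_i=\sum_{j=1}^Na_{ij}(z_i-z_j),\end{cases}\qquad i=1,\dots,N,$$ where $u_i=\mathrm{col}(u_{i1},\dots,u_{im})$ is obtained from $v_i=\mathrm{col}(v_{i1},\dots,v_{im})$ by $u_{i\iota}^{(n-r_\iota)}=v_{i\iota}$ if $n>r_\iota$ and $u_{i\iota}=v_{i\iota}$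 if $n=r_\iota$. Furthermore, if in addition there are constants $\omega,\vartheta>0$ such that every $f_i$ is $\omega$-strongly convex with $\vartheta$-Lipschitz gradient, then $y_i(t)$ converges to $y^*$ exponentially as $t\to\infty$ for $i=1,\dots,N$.
   Context: Optimal output consensus problem: given the agents, the graph and the local costs (each $f_i$ known only to agent $i$), a distributed control (agent $i$ uses only its own data and information exchanged with its neighbors) solves the problem if all trajectories of the agents are bounded and $\lim_{t\to+\infty}\|y_i(t)-y^*\|=0$ for all $i$, where $y^*$ is the optimal solution of $\min_{y\in\mathbb{R}^m}f(y)$, $f(y)=\sum_{i=1}^Nf_i(y)$. Graph: nodes $1,\dots,N$, no self-loops, $a_{ii}=0$, $a_{ij}=a_{ji}\ge 0$, with $a_{ij}>0$ iff there is an edge between $i$ and $j$. Convexity: a differentiable $f_i$ is strictly convex if $f_i(\zeta_1)-f_i(\zeta_2)>\nabla f_i(\zeta_2)^{\mathrm T}(\zeta_1-\zeta_2)$ for $\zeta_1\ne\zeta_2$; it is $\omega$-strongly convex if $(\nabla f_i(\zeta_1)-\nabla f_i(\zeta_2))^{\mathrm T}(\zeta_1-\zeta_2)\ge\omega\|\zeta_1-\zeta_2\|^2$ for all $\zeta_1,\zeta_2$. Vector relative degree: with $\tilde C_\iota$ the $\iota$th row of $\tilde C$ and $\tilde B_j$ the $j$th column of $\tilde B$, the system has vector relative degree $(r_1,\dots,r_m)$ if $\tilde C_\iota\tilde A^k\tilde B_j=0$ for all $1\le\iota,j\le m$, $0\le k<r_\iota-1$, and the $m\times m$ matrix $\tilde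 R=[\tilde C_\iota\tilde A^{r_\iota-1}\tilde B_j]_{\iota,j}$ is nonsingular. Normal form: put $\xi^{ib}_{\iota j}=\tilde C_\iota\tilde A^{j-1}\tilde x_i$ ($1\le j\le r_\iota$, $1\le\iota\le m$) and $\xi^{ia}_\iota=\psi_\iota\tilde x_i$ ($1\le\iota\le\kappa-\sum_jr_j$), with row vectors $\psi_\iota$ satisfying $\psi_\iota\tilde B=0$ chosen so that these together form a linear change of coordinates of $\mathbb{R}^\kappa$. Let $\chi_i^b=\mathrm{col}(\xi^{ib}_{11},\dots,\xi^{ib}_{1r_1},\dots,\xi^{ib}_{m1},\dots,\xi^{ib}_{mr_m})$ and $\chi_i^a=\mathrm{col}(\xi_1^{ia},\dots,\xi^{ia}_{\kappa-\sum_jr_j})$. In these coordinates the agent reads $\dot\chi_i^a=\Pi\chi_i^a+\Psi\chi_i^b$; $\dot\xi^{ib}_{\iota j}=\xi^{ib}_{\iota(j+1)}$ for $1\le j\le r_\iota-1$; $\dot\xi^{ib}_{\iota r_\iota}=\Upsilon_\iota\chi_i^a+S_\iota\chi_i^b+\tilde C_\iota\tilde A^{r_\iota-1}\tilde B\tilde u_i$; $y_i=\mathrm{col}(\xi_{11}^{ib},\dots,\xi_{m1}^{ib})$. This defines $\Pi,\Psi,\Upsilon_\iota,S_\iota$; $\Upsilon=\mathrm{col}(\Upsilon_1,\dots,\Upsilon_m)$, $S=\mathrm{col}(S_1,\dots,S_m)$. Minimum-phase means that the zero dynamics are stable, i.e. $\Pi$ is Hurwitz (all eigenvalues have negative real parts).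 Derivatives used in the control: $y_i^{(j)}=\mathrm{col}(y_{i1}^{(j)},\dots,y_{im}^{(j)})$ with $y_{i\iota}^{(j)}=\xi^{ib}_{\iota(j+1)}$ if $j\le r_\iota-1$, $y_{i\iota}^{(j)}=u_{i\iota}$ if $j=r_\iota$, and $y_{i\iota}^{(j)}=u_{i\iota}^{(j-r_\iota)}$ if $j>r_\iota$. The quantities $u_{i\iota},\dots,u_{i\iota}^{(n-r_\iota-1)}$ (for $n>r_\iota$), $z_i,\lambda_i\in\mathbb{R}^m$ are controller states. A polynomial is Hurwitz if all its roots have negative real parts. *)

(* Defs.v *)
From HB Require Import structures.
From mathcomp Require Import all_boot all_order all_algebra.
From mathcomp Require Import all_classical all_reals all_analysis.
From mathcomp.real_closed Require Import complex.

Set Implicit Arguments.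
Unset Strict Implicit.
Unset Printing Implicit Defensive.

Import Order.TTheory GRing.Theory Num.Theory.
Import numFieldNormedType.Exports.

Local Open Scope classical_set_scope.
Local Open Scope ring_scope.

(* Euclidean structure: the library norm on matrices is the sup norm. *)

Definition dot (R : realType) (d : nat) (x y : 'cV[R]_d) : R :=
  (x^T *m y) 0 0.

Definition enorm (R : realType) (d : nat) (x : 'cV[R]_d) : R :=
  Num.sqrt (dot x x).

(* Only meaningful where g is differentiable (partial derivatives are total
   in the library). *)
Definition grad (R : realType) (d : nat) (g : 'cV[R]_d -> R) (x : 'cV[R]_d) :
    'cV[R]_d :=
  \col_j 'D_(delta_mx j 0) g x.

Definition strictly_convex (R : realType) (d : nat) (g : 'cV[R]_d -> R) :=
  forall x1 x2, x1 != x2 -> g x1 - g x2 > dot (grad g x2) (x1 - x2).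

Definition strongly_convex (R : realType) (d : nat) (omega : R)
    (g : 'cV[R]_d -> R) :=
  forall x1 x2,
    dot (grad g x1 - grad g x2) (x1 - x2) >= omega * enorm (x1 - x2) ^+ 2.

Definition lipschitz_grad (R : realType) (d : nat) (theta : R)
    (g : 'cV[R]_d -> R) :=
  forall x1 x2, enorm (grad g x1 - grad g x2) <= theta * enorm (x1 - x2).

Definition minimizer (R : realType) (d : nat) (g : 'cV[R]_d -> R)
    (x : 'cV[R]_d) :=
  forall y, g x <= g y.

Definition hurwitz_mx (R : realType) (d : nat) (M : 'M[R]_d) :=
  forall l : R[i],
    eigenvalue (map_mx (real_complex R) M) l -> complex.Re l < 0.

Definition hurwitz_poly (R : realType) (p : {poly R}) :=
  forall l : R[i], root (map_poly (real_complex R) p) l -> complex.Re l < 0.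

(* [a] is the matrix of weights; i and j are adjacent iff 0 < a i j. *)
Definition undirected_graph (R : realType) (N : nat) (a : 'M[R]_N) :=
  [/\ forall i, a i i = 0, forall i j, a i j = a j i & forall i j, 0 <= a i j].

Definition connected_graph (R : realType) (N : nat) (a : 'M[R]_N) :=
  forall i j : 'I_N, connect (fun i j => 0 < a i j) i j.

(* [x] solves x' = [rhs] on [0, T[, where T may be +oo: the solution is
   continuous on [0, T[ (one-sidedly at 0) and differentiable on ]0, T[. *)
Definition solution_on (R : realType) (V : normedModType R) (T : \bar R)
    (x rhs : R -> V) :=
  {within [set t : R | 0 <= t /\ (t%:E < T)%E], continuous x} /\
  forall t : R, 0 < t -> (t%:E < T)%E -> is_derive t 1 x (rhs t).

Definition bounded_on (R : realType) (d : nat) (T : \bar R)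
    (x : R -> 'cV[R]_d) :=
  exists M : R, forall t : R, 0 <= t -> (t%:E < T)%E -> enorm (x t) <= M.

Definition converges_to (R : realType) (d : nat) (x : R -> 'cV[R]_d)
    (l : 'cV[R]_d) :=
  enorm (x t - l) @[t --> +oo] --> (0 : R).

Definition converges_exponentially_to (R : realType) (d : nat)
    (x : R -> 'cV[R]_d) (l : 'cV[R]_d) :=
  exists2 alpha : R, 0 < alpha &
  exists M : R, forall t : R, 0 <= t -> enorm (x t - l) <= M * expR (- alpha * t).

(* A control law with exchanged signals valued in E.  [K g i T x u e] means:
   on [0, T[, agent i, with cost g and state x, may apply the input u when the
   agents exchange the signals e (e i being the one sent by agent i).  Being a
   relation, K may hide further controller states of agent i. *)
Definition control_law (R : realType) (N kappa m : nat) (E : Type) :=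
  ('cV[R]_m -> R) -> 'I_N -> \bar R ->
  (R -> 'cV[R]_kappa) -> (R -> 'cV[R]_m) -> ('I_N -> R -> E) -> Prop.

Definition distributed (R : realType) (N kappa m : nat) (E : Type)
    (a : 'M[R]_N) (K : control_law R N kappa m E) :=
  forall g i T x u e e',
    (forall j, j = i \/ 0 < a i j -> e j = e' j) ->
    K g i T x u e -> K g i T x u e'.

Definition closed_loop (R : realType) (N kappa m : nat) (E : Type)
    (A : 'M[R]_kappa) (B : 'M[R]_(kappa, m)) (f : 'I_N -> 'cV[R]_m -> R)
    (K : control_law R N kappa m E) (T : \bar R)
    (x : 'I_N -> R -> 'cV[R]_kappa) :=
  exists (u : 'I_N -> R -> 'cV[R]_m) (e : 'I_N -> R -> E),
  forall i, solution_on T (x i) (fun t => A *m x i t + B *m u i t) /\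
            K (f i) i T (x i) (u i) e.

(* Trajectories on bounded intervals [0, T[ are included, so that boundedness
   also excludes finite escape times. *)
Definition solves_optimal_output_consensus (R : realType) (N kappa m : nat)
    (E : Type) (A : 'M[R]_kappa) (B : 'M[R]_(kappa, m)) (C : 'M[R]_(m, kappa))
    (a : 'M[R]_N) (f : 'I_N -> 'cV[R]_m -> R) (ystar : 'cV[R]_m)
    (K : control_law R N kappa m E) :=
  distributed a K /\
  forall (T : \bar R) (x : 'I_N -> R -> 'cV[R]_kappa),
    (0 < T)%E -> closed_loop A B f K T x ->
    (forall i, bounded_on T (x i)) /\
    (T = +oo%E -> forall i, converges_to (fun t => C *m x i t) ystar).

(* The matrix with rows C_i A^(r_i - 1) B. *)
Definition decoupling_mx (R : realType) (kappa m : nat) (A : 'M[R]_kappa)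
    (B : 'M[R]_(kappa, m)) (C : 'M[R]_(m, kappa)) (r : 'I_m -> nat) :
    'M[R]_m :=
  \matrix_(i < m) (row i C *m A ^+ (r i).-1 *m B).

Definition vector_relative_degree (R : realType) (kappa m : nat)
    (A : 'M[R]_kappa) (B : 'M[R]_(kappa, m)) (C : 'M[R]_(m, kappa))
    (r : 'I_m -> nat) :=
  [/\ forall i, (0 < r i)%N,
      forall (i j : 'I_m) (k : nat), (k < (r i).-1)%N ->
        row i C *m A ^+ k *m col j B = 0 &
      decoupling_mx A B C r \in unitmx].

(* xi_(i, j) = C_i A^(j - 1) x, for 1 <= j. *)
Definition xi (R : realType) (kappa m : nat) (A : 'M[R]_kappa)
    (C : 'M[R]_(m, kappa)) (i : 'I_m) (j : nat) (x : 'cV[R]_kappa) : R :=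
  (row i C *m A ^+ j.-1 *m x) 0 0.

(* col(xi_(1,1), ..., xi_(1,r_1), ..., xi_(m,1), ..., xi_(m,r_m)); ordinals
   start at 0, hence the shift. *)
Definition chib (R : realType) (kappa m : nat) (A : 'M[R]_kappa)
    (C : 'M[R]_(m, kappa)) (r : 'I_m -> nat) (x : 'cV[R]_kappa) :
    'cV[R]_(\sum_i r i) :=
  \mxcol_(i < m) \col_(j < r i) xi A C i j.+1 x.

(* The rows of psi complete the xi_(i, j) to coordinates of R^kappa in which
   the agent x' = A x + B u reads
     chia' = Pi chia + Psi chib,
     xi_(i, j)' = xi_(i, j + 1)  for 1 <= j < r_i,
     xi_(i, r_i)' = Upsilon_i chia + S_i chib + C_i A^(r_i - 1) B u,
   where chia = psi x and the value of a coordinate at A x + B u is its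
   derivative along the dynamics.  This determines Pi, Psi, Upsilon and S. *)
Definition normal_form (R : realType) (kappa m : nat)
    (A : 'M[R]_kappa) (B : 'M[R]_(kappa, m)) (C : 'M[R]_(m, kappa))
    (r : 'I_m -> nat) (psi : 'M[R]_(kappa - \sum_i r i, kappa))
    (Pi : 'M[R]_(kappa - \sum_i r i))
    (Psi : 'M[R]_(kappa - \sum_i r i, \sum_i r i))
    (Upsilon : 'M[R]_(m, kappa - \sum_i r i))
    (S : 'M[R]_(m, \sum_i r i)) :=
  [/\ psi *m B = 0,
      bijective (fun x : 'cV[R]_kappa => col_mx (psi *m x) (chib A C r x)) &
      forall (x : 'cV[R]_kappa) (u : 'cV[R]_m),
      [/\ psi *m (A *m x + B *m u) = Pi *m (psi *m x) + Psi *m chib A C r x,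
          forall i j, (1 <= j < r i)%N ->
            xi A C i j (A *m x + B *m u) = xi A C i j.+1 x &
          forall i, xi A C i (r i) (A *m x + B *m u) =
            (row i Upsilon *m (psi *m x) + row i S *m chib A C r x
             + row i C *m A ^+ (r i).-1 *m B *m u) 0 0]].

(* y^(k), given the state x and the derivatives [w i l] of order l of the
   inputs u_i of the chains of integrators. *)
Definition output_derivative (R : realType) (kappa m : nat) (A : 'M[R]_kappa)
    (C : 'M[R]_(m, kappa)) (r : 'I_m -> nat) (k : nat) (x : 'cV[R]_kappa)
    (w : 'I_m -> nat -> R) : 'cV[R]_m :=
  \col_i (if (k < r i)%N then xi A C i k.+1 x else w i (k - r i)%N).

(* The exchanged signal of agent j is the pair (z_j, lambda_j).  [w i k] is the
   k-th derivative of u_i, a controller state for k < n - r_i, while the one of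
   order n - r_i is v_i; in particular u_i = w i 0 = v_i if n = r_i. *)
Definition consensus_control (R : realType) (N kappa m : nat)
    (A : 'M[R]_kappa) (B : 'M[R]_(kappa, m)) (C : 'M[R]_(m, kappa))
    (r : 'I_m -> nat) (psi : 'M[R]_(kappa - \sum_i r i, kappa))
    (Upsilon : 'M[R]_(m, kappa - \sum_i r i))
    (S : 'M[R]_(m, \sum_i r i))
    (a : 'M[R]_N) (n : nat) (c : nat -> R) (eps : R) :
    control_law R N kappa m ('cV[R]_m * 'cV[R]_m) :=
  fun g i T x utilde e =>
  exists w : 'I_m -> nat -> R -> R,
  let z j t := (e j t).1 in
  let lambda j t := (e j t).2 in
  let v t : 'cV[R]_m := - (eps ^+ n)^-1 *:
    (c 0%N *: (C *m x t - z i t) +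
     \sum_(1 <= k < n) (eps ^+ k * c k) *:
        output_derivative A C r k (x t) (fun j l => w j l t)) in
  [/\ solution_on T (z i) (fun t =>
        - grad g (z i t) - \sum_j a i j *: (lambda i t - lambda j t)),
      solution_on T (lambda i) (fun t =>
        \sum_j a i j *: (z i t - z j t)),
      forall (j : 'I_m) (k : nat), (k < n - r j)%N ->
        solution_on T (w j k : R -> R^o) (w j k.+1),
      forall (j : 'I_m) (t : R), 0 <= t -> (t%:E < T)%E ->
        w j (n - r j)%N t = v t j 0 &
      forall t : R, 0 <= t -> (t%:E < T)%E ->
        utilde t = invmx (decoupling_mx A B C r) *m
          (- (Upsilon *m (psi *m x t)) - S *m chib A C r (x t)
           + \col_j w j 0%N t)].

(* Main.v *)
(* The dynamics of (z, lambda) is a saddle-point flow.  Let zs repeat the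
   minimizer ystar for every agent and let L ls = - grad f(zs), with L the graph
   Laplacian.  The energy V = (|z - zs|^2 + |lambda - ls|^2) / 2 has derivative
   - <z - zs, grad f(z) - grad f(zs)> <= 0, so z and lambda are bounded; z is then
   Lipschitz in time, and this dissipation is bounded below away from zs, so z
   tends to zs.  Under strong convexity, adding a small multiple of
   <z - zs, L (lambda - ls)> to V makes the decay exponential.

   Feedback linearization turns every output component into a chain of n
   integrators which, after rescaling the k-th derivative by eps^k, is a stable
   linear filter of z - ystar; the zero dynamics is a stable filter of this chain.
   Boundedness, convergence and exponential convergence pass through a stable
   linear filter x' = M x + g by triangularizing M over the complex numbers,
   which reduces the question to scalar filters. *)
Require Import Defs.
From HB Require Import structures.
From mathcomp Require Import all_boot all_order all_algebra.
From mathcomp Require Import all_classical all_reals all_analysis.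
From mathcomp.real_closed Require Import complex.
From mathcomp Require Import ring lra.

Set Implicit Arguments.
Unset Strict Implicit.
Unset Printing Implicit Defensive.

Import Order.TTheory GRing.Theory Num.Theory.
Import numFieldNormedType.Exports.

Local Open Scope classical_set_scope.
Local Open Scope ring_scope.

(** * Real solutions *)

Section Solutions.
Context {R : realType} (T : \bar R).

Lemma sol_cst (k : R) : @solution_on R R^o T (fun=> k) (fun=> 0).
Proof. by split=> [|t _ _]; [move=> ?; exact: cvg_cst|exact: is_derive_cst]. Qed.

Lemma solD (x y dx dy : R -> R) :
  @solution_on R R^o T x dx -> @solution_on R R^o T y dy ->
  @solution_on R R^o T (fun t => x t + y t) (fun t => dx t + dy t).
Proof.
move=> [cx sx] [cy sy]; split=> [|t t0 tT].
  by move=> ?; apply: cvgD; [exact: cx|exact: cy].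
by apply: is_deriveD; [exact: sx|exact: sy].
Qed.

Lemma solM (x y dx dy : R -> R) :
  @solution_on R R^o T x dx -> @solution_on R R^o T y dy ->
  @solution_on R R^o T (fun t => x t * y t) (fun t => dx t * y t + x t * dy t).
Proof.
move=> [cx sx] [cy sy]; split=> [|t t0 tT].
  by move=> ?; apply: cvgM; [exact: cx|exact: cy].
have -> : dx t * y t + x t * dy t = x t *: dy t + y t *: dx t.
  by rewrite /GRing.scale /= addrC [dx t * _]mulrC.
by apply: is_deriveM; [exact: sx|exact: sy].
Qed.

Lemma solZ k (x dx : R -> R) : @solution_on R R^o T x dx ->
  @solution_on R R^o T (fun t => k * x t) (fun t => k * dx t).
Proof.
move=> sx; have := solM (sol_cst k) sx.
by congr solution_on; apply/funext => t; rewrite mul0r add0r.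
Qed.

Lemma solB (x y dx dy : R -> R) :
  @solution_on R R^o T x dx -> @solution_on R R^o T y dy ->
  @solution_on R R^o T (fun t => x t - y t) (fun t => dx t - dy t).
Proof.
move=> sx sy; have := solD sx (solZ (-1) sy).
by congr solution_on; apply/funext => t; rewrite mulN1r.
Qed.

Lemma sol_sum (I : Type) (r : seq I) (P : pred I) (x dx : I -> R -> R) :
  (forall i, @solution_on R R^o T (x i) (dx i)) ->
  @solution_on R R^o T (fun t => \sum_(i <- r | P i) x i t)
                       (fun t => \sum_(i <- r | P i) dx i t).
Proof.
move=> s; elim: r => [|i r IH].
  by under eq_fun do rewrite big_nil; under [X in solution_on _ _ X]eq_fun do
    rewrite big_nil; exact: sol_cst.
under eq_fun do rewrite big_cons; under [X in solution_on _ _ X]eq_fun do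
  rewrite big_cons.
by case: (P i) => //; exact: solD.
Qed.

Lemma sol_expR (k : R) :
  @solution_on R R^o T (fun t => expR (k * t)) (fun t => k * expR (k * t)).
Proof.
have d t : is_derive t (1 : R) (fun t => expR (k * t)) (k * expR (k * t)).
  have : is_derive t (1 : R) ( *%R k) (k *: 1).
    exact: (@is_deriveZ _ _ _ _ k).
  rewrite /GRing.scale /= mulr1 => dk.
  rewrite mulrC; exact: (@is_derive1_comp _ _ _ _ _ _ (is_derive_expR _) dk).
split=> [|t _ _]; last exact: d.
apply: continuous_subspaceT => t.
by apply/differentiable_continuous/derivable1_diffP; have [] := d t.
Qed.

(** The equation is required on []0, T[] only, so identities that hold there, such as the control
    law, may be substituted in its right-hand side. *)
Lemma sol_eqr (V : normedModType R) (x dx dx' : R -> V) :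
  (forall t, 0 < t -> (t%:E < T)%E -> dx t = dx' t) ->
  solution_on T x dx -> solution_on T x dx'.
Proof. by move=> e [cx sx]; split=> // t t0 tT; rewrite -e//; exact: sx. Qed.

Lemma sol_entry p q (X dX : R -> 'M[R]_(p, q)) i j :
  solution_on T X dX ->
  @solution_on R R^o T (fun t => X t i j) (fun t => dX t i j).
Proof.
move=> [cX sX]; split=> [|t t0 tT].
  move=> t; apply: (continuous_comp (g := fun M : 'M[R]_(p, q) => M i j)).
    exact: cX.
  exact: coord_continuous.
have [dv <-] := sX t t0 tT.
split; first exact: (derivable_mxP _ _ _).1.
by rewrite derive_mx// mxE.
Qed.

(** Mean value theorem. The bound on [dx] is asked strictly between [s] and [t], since the
    derivative at time 0 is not specified. *)
Lemma sol_growth (x dx : R -> R) k s t : @solution_on R R^o T x dx ->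
  0 <= s -> s <= t -> (t%:E < T)%E ->
  (forall u, s < u -> u < t -> dx u <= k) -> x t - x s <= k * (t - s).
Proof.
move=> [cx sx] s0 st tT dxk.
have lT u : u <= t -> (u%:E < T)%E by move=> ut; apply: le_lt_trans tT; rewrite lee_fin.
have [->|st'] := eqVneq s t; first by rewrite !subrr !mulr0.
have [] := @MVT R x dx s t.
- by rewrite lt_neqAle st' st.
- move=> u; rewrite in_itv/= => /andP[su ut].
  by apply: sx; [exact: le_lt_trans su|exact/lT/ltW].
- apply: continuous_subspaceW cx => u /=; rewrite in_itv/= => /andP[su ut].
  by split; [exact: le_trans su|exact: lT].
move=> d; rewrite in_itv/= => /andP[su ut] ->.
by rewrite ler_wpM2r ?subr_ge0// dxk.
Qed.

Lemma sol_nonincreasing (x dx : R -> R) s t : @solution_on R R^o T x dx ->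
  0 <= s -> s <= t -> (t%:E < T)%E ->
  (forall u, s < u -> (u%:E < T)%E -> dx u <= 0) -> x t <= x s.
Proof.
move=> sx s0 st tT H; rewrite -subr_le0 -(mul0r (t - s)).
apply: (sol_growth sx s0 st tT) => u su ut; apply: H => //.
by apply: lt_trans tT; rewrite lte_fin.
Qed.

(** The integrating factor [expR (alpha * t)] makes the difference [w - p] nonincreasing. The
    function [p] serves as an explicit comparison solution. *)
Lemma sol_gronwall alpha (w dw p dp : R -> R) s t :
  @solution_on R R^o T w dw -> @solution_on R R^o T p dp ->
  0 <= s -> s <= t -> (t%:E < T)%E ->
  (forall u, s < u -> (u%:E < T)%E ->
     dw u + alpha * w u <= dp u + alpha * p u) ->
  w t - p t <= expR (- (alpha * (t - s))) * (w s - p s).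
Proof.
move=> sw sp s0 st tT H.
have d u : s < u -> (u%:E < T)%E -> alpha * expR (alpha * u) * (w u - p u) +
    expR (alpha * u) * (dw u - dp u) <= 0.
  move=> u0 uT; have := H u u0 uT; have := expR_gt0 (alpha * u).
  set E := expR _ => E0 h.
  have : E * (dw u + alpha * w u) <= E * (dp u + alpha * p u) by rewrite ler_pM2l.
  lra.
have := sol_nonincreasing (solM (sol_expR alpha)
  (solB sw sp)) s0 st tT d.
move=> h; rewrite -(ler_pM2l (expR_gt0 (alpha * t))) mulrA -expRD.
suff -> : alpha * t - alpha * (t - s) = alpha * s by [].
by ring.
Qed.

End Solutions.

(** * Signal classes *)

(** Upper bounds suffice in this class and the next two, because they are applied to nonnegative
    signals. *)
Definition is_bounded_signal (R : realType) (T : \bar R) (q : R -> R) :=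
  exists M, forall t, 0 <= t -> (t%:E < T)%E -> q t <= M.

Definition is_vanishing_signal (R : realType) (q : R -> R) :=
  forall e, 0 < e -> exists2 s, 0 <= s & forall t, s <= t -> q t <= e.

Definition is_exp_vanishing_signal (R : realType) (q : R -> R) :=
  exists2 beta, 0 < beta &
  exists M, forall t, 0 <= t -> q t <= M * expR (- beta * t).

(* The properties of nonnegative signals on [0, T[ which pass through stable
   filters: boundedness, convergence to 0 and exponential convergence to 0 are
   treated at once, applied to squares of signals. *)
Record signal_class (R : realType) (T : \bar R) (P : (R -> R) -> Prop) := {
  signal_0 : P (fun=> 0);
  signal_le : forall k p q, 0 <= k ->
    (forall t, 0 <= t -> (t%:E < T)%E -> p t <= k * q t) -> P q -> P p;
  signalD : forall p q, P p -> P q -> P (fun t => p t + q t);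
  signal_filter : forall alpha w dw q, 0 < alpha ->
    @solution_on R R^o T w dw -> (forall t, 0 <= w t) -> (forall t, 0 <= q t) ->
    (forall t, 0 < t -> (t%:E < T)%E -> dw t <= - alpha * w t + q t) ->
    P q -> P w }.

Section SignalClasses.
Context {R : realType}.

Lemma bounded_signal_class (T : \bar R) : signal_class T (is_bounded_signal T).
Proof.
split.
- by exists 0.
- move=> k p q k0 pq [M qM]; exists (k * M) => t t0 tT.
  by apply: le_trans (pq t t0 tT) _; rewrite ler_wpM2l// qM.
- move=> p q [M pM] [M' qM']; exists (M + M') => t t0 tT.
  by rewrite lerD ?pM ?qM'.
(* Comparison with [M / al], the equilibrium of the filter under the constant forcing [M]. *)
move=> al w dw q al0 sw w0 q0 H [M qM]; exists (M / al + `|w 0 - M / al|) => t t0 tT.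
rewrite -lerBlDl.
apply: le_trans (sol_gronwall (alpha := al) sw (sol_cst _ (M / al)) (lexx 0) t0 tT _) _
  => [u u0 uT|].
  rewrite add0r [al * (M / al)]mulrC divfK ?gt_eqF//.
  by have := H u u0 uT; have := qM u (ltW u0) uT; lra.
apply: le_trans (ler_norm _) _; rewrite normrM ger0_norm ?expR_ge0//.
rewrite ler_piMl// -expR0 ler_expR oppr_le0 subr0 mulr_ge0// ltW//.
Qed.

Lemma vanishing_signal_class : signal_class +oo%E (@is_vanishing_signal R).
Proof.
split.
- by move=> e e0; exists 0 => // t _; exact: ltW.
- move=> k p q k0 pq Pq e e0.
  (* [k] may be 0, hence the division by [k + 1]. *)
  have k1 : 0 < k + 1 by rewrite ltr_wpDl.
  have [s s0 H] := Pq (e / (k + 1)) (divr_gt0 e0 k1).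
  exists s => // t st; apply: le_trans (pq t (le_trans s0 st) (ltry _)) _.
  apply: (@le_trans _ _ (k * (e / (k + 1)))); first by rewrite ler_wpM2l ?H.
  by rewrite mulrCA -[leRHS]mulr1 ler_wpM2l ?(ltW e0)// ler_pdivrMr// mul1r lerDl.
- move=> p q Pp Pq e e0.
  have e2 : 0 < e / 2 by rewrite divr_gt0.
  have [s s0 H] := Pp _ e2; have [s' s'0 H'] := Pq _ e2.
  exists (Num.max s s'); first by rewrite le_max s0.
  move=> t; rewrite ge_max => /andP[st s't].
  by rewrite [e]splitr lerD ?H ?H'.
move=> al w dw q al0 sw w0 q0 H Pq e e0.
have e2 : 0 < e / 2 by rewrite divr_gt0.
have [s s0 Hs] := Pq (al * (e / 2)) (mulr_gt0 al0 e2).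
(* From [s] on, the comparison solution is the equilibrium [e / 2]. The initial excess, at most
   [w s], decays below [e / 2] within the added delay, because [expR y >= 1 + y]. *)
exists (s + w s / (al * (e / 2))).
  by rewrite addr_ge0// divr_ge0// ltW// mulr_gt0.
move=> t; rewrite -lerBrDl => st.
have st' : s <= t.
  by rewrite -subr_ge0; apply: le_trans st; rewrite divr_ge0// ltW// mulr_gt0.
have h u : s < u -> (u%:E < +oo)%E -> dw u + al * w u <= 0 + al * (e / 2).
  by move=> su uT; have := H u (le_lt_trans s0 su) uT; have := Hs u (ltW su); lra.
have {h} := sol_gronwall sw (sol_cst _ (e / 2)) s0 st' (ltry _) h.
have : expR (- (al * (t - s))) * w s <= e / 2.
  rewrite expRN mulrC ler_pdivrMr ?expR_gt0//.
  apply: (@le_trans _ _ (e / 2 * (1 + al * (t - s)))); last first.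
    by rewrite ler_wpM2l ?(ltW e2)// expR_ge1Dx.
  move: st; rewrite ler_pdivrMr ?mulr_gt0// => st.
  by apply: le_trans st _; rewrite -subr_ge0 (_ : _ - _ = e / 2) ?ltW//; ring.
have : 0 <= expR (- (al * (t - s))) * (e / 2) by rewrite mulr_ge0 ?expR_ge0// ltW.
by lra.
Qed.

Lemma exp_vanishing_signal_class :
  signal_class +oo%E (@is_exp_vanishing_signal R).
Proof.
split.
- by exists 1 => //; exists 0 => t _; rewrite mul0r.
- move=> k p q k0 pq [b b0 [M qM]]; exists b => //; exists (k * M) => t t0.
  apply: le_trans (pq t t0 (ltry _)) _.
  by rewrite -mulrA ler_wpM2l// qM.
- move=> p q [b b0 [M pM]] [b' b'0 [M' qM]].
  exists (Num.min b b'); first by rewrite lt_min b0.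
  exists (`|M| + `|M'|) => t t0; rewrite mulrDl lerD//.
    apply: le_trans (pM t t0) _; apply: le_trans (_ : _ <= `|M| * expR (- b * t)) _.
      by rewrite ler_wpM2r ?expR_ge0 ?ler_norm.
    by rewrite ler_wpM2l// ler_expR ler_wpM2r// lerN2 ge_min lexx.
  apply: le_trans (qM t t0) _; apply: le_trans (_ : _ <= `|M'| * expR (- b' * t)) _.
    by rewrite ler_wpM2r ?expR_ge0 ?ler_norm.
  by rewrite ler_wpM2l// ler_expR ler_wpM2r// lerN2 ge_min lexx orbT.
move=> al w dw q al0 sw w0 q0 H [b b0 [M qM]].
(* With a rate at most [b] and strictly below [al], [|M| / (al - c) * expR (- c * t)] solves exactly
   the filter forced by [|M| * expR (- c * t)]. *)
pose c := Num.min b (al / 2).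
have c0 : 0 < c by rewrite lt_min b0 divr_gt0.
have cb : c <= b by rewrite ge_min lexx.
have cal : 0 < al - c.
  rewrite subr_gt0; apply: le_lt_trans (_ : al / 2 < al); last by lra.
  by rewrite ge_min lexx orbT.
exists c => //; exists (`|M| / (al - c) + w 0) => t t0.
have h u : 0 < u -> (u%:E < +oo)%E -> dw u + al * w u <=
    `|M| / (al - c) * (- c * expR (- c * u)) + al * (`|M| / (al - c) * expR (- c * u)).
  move=> u0 uT; rewrite [leRHS](_ : _ = `|M| * expR (- c * u)); last first.
    by field; rewrite gt_eqF.
  have := H u u0 uT; have := qM u (ltW u0).
  have : M * expR (- b * u) <= `|M| * expR (- c * u).
    apply: le_trans (_ : _ <= `|M| * expR (- b * u)) _.
      by rewrite ler_wpM2r ?expR_ge0 ?ler_norm.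
    by rewrite ler_wpM2l// ler_expR ler_wpM2r ?(ltW u0)// lerN2.
  by lra.
have {h} := sol_gronwall sw (solZ (`|M| / (al - c)) (sol_expR _ (- c))) (lexx 0) t0
  (ltry _) h.
rewrite mulrDl -lerBlDl => h; apply: le_trans h _; rewrite mulrC.
apply: le_trans (_ : _ <= w 0 * expR (- (al * (t - 0)))) _.
  by rewrite ler_wpM2r ?expR_ge0// gerBl mulr_ge0 ?expR_ge0// divr_ge0// ltW.
rewrite ler_wpM2l// ler_expR subr0 -mulNr ler_wpM2r// lerN2 ltW// -subr_gt0//.
Qed.

End SignalClasses.

(** * Stable linear filters *)

(** Squared modulus with values in [R], as signal classes require; the norm of [R[i]] is itself
    complex-valued. *)
Definition sqmod (R : realType) (z : R[i]) : R :=
  complex.Re z ^+ 2 + complex.Im z ^+ 2.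

Section Hurwitz.
Context {R : realType} (T : \bar R) (P : (R -> R) -> Prop).
Hypothesis PP : signal_class T P.

(** Parallelogram identity: the gap is [sqmod (x - y)]. *)
Lemma sqmodD_le (x y : R[i]) : sqmod (x + y) <= 2 * (sqmod x + sqmod y).
Proof.
case: x y => [a b] [c d]; rewrite /sqmod /= -subr_ge0.
rewrite (_ : _ - _ = (a - c) ^+ 2 + (b - d) ^+ 2); last by ring.
by rewrite addr_ge0// sqr_ge0.
Qed.

Lemma sqmodM (x y : R[i]) : sqmod (x * y) = sqmod x * sqmod y.
Proof. by case: x y => [a b] [c d]; rewrite /sqmod /=; ring. Qed.

Lemma sqmod_ge0 (x : R[i]) : 0 <= sqmod x.
Proof. by rewrite addr_ge0// sqr_ge0. Qed.

Lemma sqmod_real (x : R) : sqmod x%:C%C = x ^+ 2.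
Proof. by rewrite /sqmod /= expr0n addr0. Qed.

Lemma signal_scale k p : 0 <= k -> P p -> P (fun t => k * p t).
Proof. by move=> k0; apply: (signal_le PP k0). Qed.

Lemma signal_sqmod_lincomb (I : finType) (A : pred I) (c : I -> R[i])
    (z : I -> R -> R[i]) :
  (forall i, A i -> P (fun t => sqmod (z i t))) ->
  P (fun t => sqmod (\sum_(i | A i) c i * z i t)).
Proof.
move=> Pz; pose Q (z : R -> R[i]) := P (fun t => sqmod (z t)).
have QD x y : Q x -> Q y -> Q (fun t => x t + y t).
  move=> Qx Qy; apply: (signal_le PP (ler0n R 2)) (signalD PP Qx Qy) => t _ _.
  exact: sqmodD_le.
rewrite -/(Q _); elim: (index_enum I) => [|i s IH].
  rewrite /Q (_ : (fun t => _) = (fun=> 0)); first exact: signal_0 PP.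
  by apply/funext => t; rewrite big_nil /sqmod /= expr0n addr0.
rewrite (_ : (fun t => _) = (fun t => (if A i then c i * z i t else 0) +
    \sum_(j <- s | A j) c j * z j t)); last first.
  by apply/funext => t; rewrite big_cons; case: (A i); rewrite ?add0r.
have [Ai|_] := boolP (A i); last first.
  by move: IH; congr Q; apply/funext => t; rewrite add0r.
apply: QD => //.
apply: (signal_le PP (sqmod_ge0 (c i))) (Pz i Ai) => t _ _.
by rewrite sqmodM.
Qed.

Lemma sol_complex_lincomb d (u : 'I_d -> R[i]) (x dx : R -> 'cV[R]_d) :
  (forall j, @solution_on R R^o T (fun t => x t j 0) (fun t => dx t j 0)) ->
  @solution_on R R^o T (fun t => complex.Re (\sum_j u j * (x t j 0)%:C%C))
    (fun t => complex.Re (\sum_j u j * (dx t j 0)%:C%C)) /\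
  @solution_on R R^o T (fun t => complex.Im (\sum_j u j * (x t j 0)%:C%C))
    (fun t => complex.Im (\sum_j u j * (dx t j 0)%:C%C)).
Proof.
move=> sx.
have re (y : 'cV[R]_d) : complex.Re (\sum_j u j * (y j 0)%:C%C) =
    \sum_j complex.Re (u j) * y j 0.
  rewrite (big_morph (@complex.Re R) (id1 := 0) (op1 := +%R)) //; last by case=> ? ? [].
  by apply: eq_bigr => j _; case: (u j) => a b /=; rewrite mulr0 subr0.
have im (y : 'cV[R]_d) : complex.Im (\sum_j u j * (y j 0)%:C%C) =
    \sum_j complex.Im (u j) * y j 0.
  rewrite (big_morph (@complex.Im R) (id1 := 0) (op1 := +%R)) //; last by case=> ? ? [].
  by apply: eq_bigr => j _; case: (u j) => a b /=; rewrite mulr0 add0r.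
by split; [under eq_fun do rewrite re; under [X in solution_on _ _ X]eq_fun do
  rewrite re | under eq_fun do rewrite im; under [X in solution_on _ _ X]eq_fun do
  rewrite im]; apply: sol_sum => j; exact: solZ.
Qed.

(** For [w = a + i b], the derivative of [|w|^2] is [2 Re(l) |w|^2 + 2 Re(conj(w) h)]. Half of the
    decay absorbs the last term by completing the square, which leaves a real filter of rate
    [- Re(l)] driven by [|h|^2 / (- Re(l))]. *)
Lemma signal_complex_filter (l : R[i]) (a b da db : R -> R) (h : R -> R[i]) :
  complex.Re l < 0 ->
  @solution_on R R^o T a da -> @solution_on R R^o T b db ->
  (forall t, 0 < t -> (t%:E < T)%E ->
    (da t +i* db t)%C = l * (a t +i* b t)%C + h t) ->
  P (fun t => sqmod (h t)) -> P (fun t => sqmod (a t +i* b t)%C).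
Proof.
case: l => lr li /= lr0 sa sb E Ph.
have al : 0 < - lr by rewrite oppr_gt0.
apply: (signal_filter PP al (dw := fun t => (da t * a t + a t * da t) +
   (db t * b t + b t * db t)) (q := fun t => (- lr)^-1 * sqmod (h t))).
- exact: solD (solM sa sa) (solM sb sb).
- by move=> t; exact: sqmod_ge0.
- by move=> t; rewrite mulr_ge0 ?sqmod_ge0// ltW// invr_gt0.
- move=> t t0 tT; case: (h t) (E t t0 tT) => [hr hi] /= [-> ->].
  rewrite /sqmod /= -subr_ge0.
  rewrite (_ : _ - _ = (- lr)^-1 * ((lr * a t + hr) ^+ 2 + (lr * b t + hi) ^+ 2)).
    by rewrite mulr_ge0 ?addr_ge0 ?sqr_ge0// ltW// invr_gt0.
  by field; rewrite lt_eqF.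
by apply: signal_scale => //; rewrite ltW// invr_gt0.
Qed.

(** The diagonal entries of [L] are roots of its characteristic polynomial, and a left eigenvector
    [v] of [L] gives the left eigenvector [v *m U] of [A]. *)
Lemma trig_similar_eigenvalue n (A U L : 'M[R[i]]_n) i :
  U \in unitmx -> U *m A = L *m U -> is_trig_mx L -> eigenvalue A (L i i).
Proof.
move=> uU UA tL.
have : eigenvalue L (L i i).
  rewrite eigenvalue_root_char char_poly_trig//.
  rewrite -(big_map (fun i => L i i) predT (fun z => 'X - z%:P)) root_prod_XsubC.
  by apply/mapP; exists i; rewrite ?mem_index_enum.
move=> /eigenvalueP[v vL v0]; apply/eigenvalueP; exists (v *m U).
  by rewrite -mulmxA UA mulmxA vL scalemxAl.
by apply: contra_neq v0 => /(congr1 (mulmxr (invmx U))) /=; rewrite mulmxK// mul0mx.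
Qed.

(** With [U M = L U] and [L] lower triangular, the coordinates of [U x] form a cascade: the [i]-th
    is a scalar filter with coefficient [L i i], driven by the earlier ones and by [U g]. The
    property passes down the cascade by induction on [i], then back to [x] through [invmx U]. *)
Lemma signal_hurwitz d (M : 'M[R]_d) (x g : R -> 'cV[R]_d) :
  hurwitz_mx M ->
  (forall i, @solution_on R R^o T (fun t => x t i 0)
     (fun t => (M *m x t + g t) i 0)) ->
  (forall i, P (fun t => g t i 0 ^+ 2)) -> forall i, P (fun t => x t i 0 ^+ 2).
Proof.
move=> hM sx Pg.
(* The index [i0] supplies the positive dimension needed by [Schur]. *)
move=> i0; have d0 : (0 < d)%N by apply: leq_ltn_trans (ltn_ord i0).
pose Mc := map_mx (real_complex R) M.
have [U /unitarymx_unit uU trL] := Schur Mc d0.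
pose L := conjmx U Mc.
have UM : U *m Mc = L *m U by apply/(similarP uU); exact: eqxx.
pose w i t : R[i] := \sum_j U i j * (x t j 0)%:C%C.
pose dw i t : R[i] := \sum_j U i j * ((M *m x t + g t) j 0)%:C%C.
have dwE i t : dw i t = \sum_j L i j * w j t + \sum_j U i j * (g t j 0)%:C%C.
  have mxc (W : 'M[R[i]]_d) (y : 'cV[R]_d) k :
      \sum_j W k j * (y j 0)%:C%C = (W *m map_mx (real_complex R) y) k 0.
    by rewrite mxE; apply: eq_bigr => j _; rewrite mxE.
  rewrite /dw !mxc map_mxD map_mxM mulmxDr !mulmxA UM mxE -[in LHS]mulmxA.
  by congr (_ + _); rewrite mxE; apply: eq_bigr => j _; rewrite -mxc.
have Pw i : P (fun t => sqmod (w i t)).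
  have [k] := ubnP (i : nat); elim: k i => // k IH i; rewrite ltnS => ik.
  have [sa sb] := sol_complex_lincomb (U i) sx.
  have hL : complex.Re (L i i) < 0.
    exact/hM/(trig_similar_eigenvalue i uU UM trL).
  have cE (z : R[i]) : (complex.Re z +i* complex.Im z)%C = z by case: z.
  have := signal_complex_filter (l := L i i) hL sa sb
    (h := fun t => \sum_(j : 'I_d | (j < i)%N) L i j * w j t +
                   \sum_j U i j * (g t j 0)%:C%C).
  under [X in _ -> _ -> P X]eq_fun do rewrite cE.
  apply=> [t t0 tT|].
    rewrite !cE -/(dw i t) -/(w i t) dwE addrA; congr (_ + _).
    rewrite (bigD1 i)//=; congr (_ + _).
    rewrite [LHS](bigID (fun j : 'I_d => (j < i)%N))/=.
    rewrite [X in _ + X]big1 ?addr0.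
      apply: eq_bigl => j; rewrite andbC; case: ltnP => //= ji.
      by case: eqP ji => // ->; rewrite ltnn.
    move=> j /andP[ji]; rewrite -leqNgt => ij.
    rewrite (is_trig_mxP trL) ?mul0r// ltn_neqAle ij andbT.
    by apply: contra_neq ji => e; exact/esym/val_inj.
  apply: (signal_le PP (ler0n R 2)) (signalD PP (signal_sqmod_lincomb
    (A := fun j : 'I_d => (j < i)%N) (L i) (z := w) _) (signal_sqmod_lincomb
    (A := predT) (U i) (z := fun j t => (g t j 0)%:C%C) _)) => [t _ _|j ji|j _].
  - exact: sqmodD_le.
  - by apply: IH; exact: leq_trans ji ik.
  - by under eq_fun do rewrite sqmod_real; exact: Pg.
move: i0 => i; have -> : (fun t => x t i 0 ^+ 2) =
    (fun t => sqmod (\sum_j invmx U i j * w j t)).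
  apply/funext => t; rewrite -sqmod_real; congr sqmod.
  have : (invmx U *m (U *m map_mx (real_complex R) (x t))) i 0 = (x t i 0)%:C%C.
    by rewrite mulKmx// mxE.
  move=> <-; rewrite mxE; apply: eq_bigr => j _; congr (_ * _).
  by rewrite mxE; apply: eq_bigr => k _; rewrite mxE.
by apply: (signal_sqmod_lincomb (A := predT)) => j _; exact: Pw.
Qed.

End Hurwitz.

(** * Chains of integrators closed by a Hurwitz polynomial *)

Lemma hurwitz_mxZ (R : realType) d (M : 'M[R]_d) (s : R) :
  0 < s -> hurwitz_mx M -> hurwitz_mx (s *: M).
Proof.
move=> s0 hM l /eigenvalueP[v vl v0].
have s0' : s%:C%C != 0 :> R[i].
  by rewrite -(rmorph0 (real_complex R)) (inj_eq (@complexI R)) gt_eqF.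
have : complex.Re (s^-1%:C%C * l) < 0.
  apply: hM; apply/eigenvalueP; exists v => //.
  rewrite -scalerA -vl map_mxZ -scalemxAr scalerA -[_ s^-1]/((real_complex R) s^-1).
  by rewrite fmorphV /= mulVf// scale1r.
by case: l {vl} => a b /=; rewrite mul0r subr0 pmulr_rlt0// invr_gt0.
Qed.

Lemma hurwitz_companionmx (R : realType) (p : {poly R}) :
  p \is monic -> hurwitz_poly p -> hurwitz_mx (companionmx p).
Proof.
move=> pm hp l; rewrite eigenvalue_root_char -map_char_poly companionmxK//.
exact: hp.
Qed.

(** The rescaled errors [e_k = eps^k eta_k - [k = 0] ys] satisfy [eps e' = companionmx p e + b],
    where [p] is the Hurwitz polynomial and [b] is zero except for [c_0 (zeta - ys)] in the last
    row. *)
Lemma signal_integrator_chain (R : realType) (T : \bar R)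
    (P : (R -> R) -> Prop) (n : nat) (c : nat -> R) (eps : R)
    (eta : nat -> R -> R) (zeta : R -> R) (ys : R) :
  signal_class T P -> 0 < eps ->
  hurwitz_poly ('X^n + \poly_(k < n) c k) ->
  (forall k, (k < n)%N -> @solution_on R R^o T (eta k) (eta k.+1)) ->
  (forall t, 0 <= t -> (t%:E < T)%E ->
     eta n t = - (eps ^+ n)^-1 * (c 0%N * (eta 0%N t - zeta t) +
       \sum_(1 <= k < n) eps ^+ k * c k * eta k t)) ->
  P (fun t => (zeta t - ys) ^+ 2) ->
  forall k, (k < n)%N ->
    P (fun t => (eps ^+ k * eta k t - (k == 0%N)%:R * ys) ^+ 2).
Proof.
move=> PP eps0 hp seta etan Pz k kn.
have n0 : (0 < n)%N by exact: leq_ltn_trans kn.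
set p := 'X^n + _ in hp.
have szc : (size (\poly_(k < n) c k) < size ('X^n : {poly R}))%N.
  by rewrite size_polyXn ltnS size_poly.
have sp : size p = n.+1 by rewrite size_polyDl// size_polyXn.
have pm : p \is monic by rewrite monicE lead_coefDl// lead_coefXn.
have pc j : (j < n)%N -> p`_j = c j.
  by move=> jn; rewrite coefD coefXn coef_poly jn ltn_eqF// add0r.
(* [companionmx p] has dimension [(size p).-1], only provably equal to [n], so vectors are indexed
   by [d]. *)
pose d := (size p).-1; have dn : d = n by rewrite /d sp.
pose e t : 'cV[R]_d := \col_i (eps ^+ i * eta i t - (i == 0%N :> nat)%:R * ys).
pose g t : 'cV[R]_d :=
  \col_i ((i == d.-1 :> nat)%:R * (eps^-1 * c 0%N * (zeta t - ys))).
have kd : (k < d)%N by rewrite dn.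
suff /(_ (Ordinal kd)) : forall i, P (fun t => e t i 0 ^+ 2).
  by congr P; apply/funext => t; rewrite mxE.
apply: (signal_hurwitz PP (M := eps^-1 *: companionmx p) (g := g)).
- by apply: hurwitz_mxZ; [rewrite invr_gt0|exact: hurwitz_companionmx].
- move=> i; rewrite (_ : (fun t => e t i 0) =
    (fun t => eps ^+ i * eta i t - (i == 0%N :> nat)%:R * ys)); last first.
    by apply/funext => t; rewrite mxE.
  have ilt : (i < n)%N by rewrite -dn.
  apply: sol_eqr (solB (solZ (eps ^+ i) (seta i ilt)) (sol_cst _ _)) => t t0 tT.
  rewrite subr0 mxE -scalemxAl mxE [(companionmx p *m _) i 0]mxE /g mxE.
  (* Every row but the last is a shift, [e_i' = eps^-1 e_(i+1)]; the last one carries the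
     feedback. *)
  have [id|id] := eqVneq (i : nat) d.-1; last first.
    rewrite mul0r addr0.
    have i1 : (i.+1 < d)%N.
      have := ltn_ord i; rewrite leq_eqVlt -/d => /orP[/eqP e1|//].
      by rewrite -e1 eqxx in id.
    rewrite (bigD1 (Ordinal i1))//= big1 ?addr0.
      by rewrite !mxE (negPf id) eqxx mul1r /= mul0r subr0 exprS -mulrA mulKf// gt_eqF.
    move=> j ji; rewrite !mxE (negPf id) (_ : (_ == _) = false) ?mul0r//.
    by apply/eqP => ij; case/eqP: ji; apply: val_inj.
  rewrite mul1r.
  have i1 : i.+1 = n by rewrite id -dn prednK// dn.
  (* Only the term [j = 0] contains [ys], which cancels against the one in [g]. *)
  pose F j := c j * (eps ^+ j * eta j t - (j == 0%N)%:R * ys).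
  rewrite (eq_bigr (fun j : 'I_d => - F j)); last first.
    by move=> j _; rewrite !mxE -/d id eqxx pc -?dn// mulNr.
  rewrite sumrN -(big_mkord xpredT F) dn big_ltn// /F /= expr0 mul1r mul1r.
  rewrite (eq_big_nat _ _ (F2 := fun j => eps ^+ j * c j * eta j t)); last first.
    move=> j /andP[j0 _]; rewrite (gtn_eqF j0) mul0r subr0 mulrA; congr (_ * _).
    exact: mulrC.
  rewrite i1 etan// 1?ltW// -i1 exprS.
  by field; rewrite expf_neq0// gt_eqF.
- move=> i; apply: (signal_le PP (sqr_ge0 (eps^-1 * c 0%N))) Pz => t _ _.
  rewrite mxE; case: eqP => _; first by rewrite mul1r exprMn.
  by rewrite mul0r expr0n/= -exprMn sqr_ge0.
Qed.

(** * Frobenius inner product and graph Laplacian *)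

Definition frob (R : realType) p q (X Y : 'M[R]_(p, q)) : R :=
  \sum_i \sum_j X i j * Y i j.

Section Frobenius.
Context {R : realType}.

Lemma frob_trace p q (X Y : 'M[R]_(p, q)) : frob X Y = \tr (X^T *m Y).
Proof.
rewrite /frob exchange_big; apply: eq_bigr => j _; rewrite mxE.
by apply: eq_bigr => i _; rewrite mxE.
Qed.

Lemma frobC p q (X Y : 'M[R]_(p, q)) : frob X Y = frob Y X.
Proof. by apply: eq_bigr => i _; apply: eq_bigr => j _; rewrite mulrC. Qed.

Lemma frobDr p q (X Y Z : 'M[R]_(p, q)) : frob X (Y + Z) = frob X Y + frob X Z.
Proof. by rewrite !frob_trace mulmxDr linearD. Qed.

Lemma frobDl p q (X Y Z : 'M[R]_(p, q)) : frob (Y + Z) X = frob Y X + frob Z X.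
Proof. by rewrite frobC frobDr ![frob X _]frobC. Qed.

Lemma frobNr p q (X Y : 'M[R]_(p, q)) : frob X (- Y) = - frob X Y.
Proof. by rewrite !frob_trace mulmxN linearN. Qed.

Lemma frobBr p q (X Y Z : 'M[R]_(p, q)) : frob X (Y - Z) = frob X Y - frob X Z.
Proof. by rewrite frobDr frobNr. Qed.

Lemma frobBl p q (X Y Z : 'M[R]_(p, q)) : frob (Y - Z) X = frob Y X - frob Z X.
Proof. by rewrite frobC frobBr ![frob X _]frobC. Qed.

Lemma frob_ge0 p q (X : 'M[R]_(p, q)) : 0 <= frob X X.
Proof.
by rewrite sumr_ge0// => i _; rewrite sumr_ge0// => j _; rewrite -expr2 sqr_ge0.
Qed.

Lemma frob_eq0 p q (X : 'M[R]_(p, q)) : frob X X = 0 -> X = 0.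
Proof.
move=> X0; apply/matrixP => i j; rewrite mxE; apply/eqP; rewrite -sqrf_eq0 expr2.
have nn k l : 0 <= X k l * X k l by rewrite -expr2 sqr_ge0.
move: X0 => /eqP; rewrite psumr_eq0; last by move=> k _; exact: sumr_ge0.
move=> /allP/(_ i (mem_index_enum _)) /=.
by rewrite psumr_eq0// => /allP/(_ j (mem_index_enum _)).
Qed.

Lemma frob_entry p q (X : 'M[R]_(p, q)) i j : X i j ^+ 2 <= frob X X.
Proof.
have nn k l : 0 <= X k l * X k l by rewrite -expr2 sqr_ge0.
rewrite /frob (bigD1 i)//= (bigD1 j)//= -addrA expr2 lerDl addr_ge0//.
  by rewrite sumr_ge0.
by rewrite sumr_ge0// => k _; rewrite sumr_ge0.
Qed.

Lemma frob_young p q (X Y : 'M[R]_(p, q)) :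
  2 * `|frob X Y| <= frob X X + frob Y Y.
Proof.
have h1 := frob_ge0 (X - Y); have h2 := frob_ge0 (X + Y).
move: h1 h2; rewrite frobBr !frobBl frobDr !frobDl (frobC Y X) => h1 h2.
case: (ger0P (frob X Y)) => _; lra.
Qed.

Lemma frob_mulmx_sym p q (L : 'M[R]_p) (X Y : 'M[R]_(p, q)) :
  L^T = L -> frob X (L *m Y) = frob (L *m X) Y.
Proof. by move=> sL; rewrite !frob_trace trmx_mul sL mulmxA. Qed.

(** Each entry of [Q *m X] is at most an absolute row sum of [Q] times the Frobenius norm of [X].
    The constant is kept above 1 so that it can be divided by. *)
Lemma frob_mulmx_le p q s (Q : 'M[R]_(p, q)) :
  exists2 k, 1 <= k &
    forall X : 'M[R]_(q, s), frob (Q *m X) (Q *m X) <= k * frob X X.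
Proof.
exists (1 + \sum_(i < p) \sum_(k < s) (\sum_j `|Q i j|) ^+ 2).
  by rewrite lerDl sumr_ge0// => i _; rewrite sumr_ge0// => k _; rewrite sqr_ge0.
move=> X; rewrite mulrDl mul1r -[leLHS]add0r lerD ?frob_ge0//.
rewrite mulr_suml; apply: ler_sum => i _; rewrite mulr_suml; apply: ler_sum => k _.
have X0 := frob_ge0 X.
rewrite -(sqr_sqrtr X0) -expr2 -exprMn -real_normK ?num_real//.
rewrite ler_sqr ?nnegrE//; last first.
  by rewrite mulr_ge0 ?sqrtr_ge0// sumr_ge0.
rewrite mxE; apply: le_trans (ler_norm_sum _ _ _) _; rewrite mulr_suml.
apply: ler_sum => j _; rewrite normrM ler_wpM2l//.
by rewrite -sqrtr_sqr ler_wsqrtr// frob_entry.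
Qed.

Lemma sol_frob (T : \bar R) p q (X dX Y dY : R -> 'M[R]_(p, q)) :
  (forall i j, @solution_on R R^o T (fun t => X t i j) (fun t => dX t i j)) ->
  (forall i j, @solution_on R R^o T (fun t => Y t i j) (fun t => dY t i j)) ->
  @solution_on R R^o T (fun t => frob (X t) (Y t))
    (fun t => frob (dX t) (Y t) + frob (X t) (dY t)).
Proof.
move=> sX sY.
rewrite (_ : (fun t => _ + _) =
    (fun t => \sum_i \sum_j (dX t i j * Y t i j + X t i j * dY t i j))).
  by apply: sol_sum => i; apply: sol_sum => j; exact: solM.
apply/funext => t; rewrite /frob -big_split; apply: eq_bigr => i _.
by rewrite -big_split.
Qed.

Lemma sol_mulmx (T : \bar R) p q s (L : 'M[R]_(s, p)) (X dX : R -> 'M[R]_(p, q)) :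
  (forall i j, @solution_on R R^o T (fun t => X t i j) (fun t => dX t i j)) ->
  forall i j, @solution_on R R^o T (fun t => (L *m X t) i j)
    (fun t => (L *m dX t) i j).
Proof.
move=> sX i j; under eq_fun do rewrite mxE.
under [X in solution_on _ _ X]eq_fun do rewrite mxE.
by apply: sol_sum => k; exact: solZ.
Qed.

End Frobenius.

Definition laplacian (R : realType) N (a : 'M[R]_N) : 'M[R]_N :=
  \matrix_(i, j) ((i == j)%:R * (\sum_l a i l) - a i j).

Section Laplacian.
Context {R : realType} (N : nat) (a : 'M[R]_N).
Hypothesis Hundir : undirected_graph a.
Hypothesis Hconn : connected_graph a.
Let L := laplacian a.

Lemma laplacian_sym : L^T = L.
Proof.
have [_ sa _] := Hundir; apply/matrixP => i j; rewrite !mxE sa eq_sym.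
by have [->|] := eqVneq i j; rewrite ?mul0r.
Qed.

Lemma mulmx_laplacian q (X : 'M[R]_(N, q)) i k :
  (L *m X) i k = \sum_j a i j * (X i k - X j k).
Proof.
rewrite mxE; under eq_bigr do rewrite mxE mulrBl.
rewrite sumrB [X in X - _](bigD1 i)//= eqxx mul1r [X in _ + X - _]big1; last first.
  by move=> j ji; rewrite eq_sym (negPf ji) !mul0r.
rewrite addr0 mulr_suml -sumrB; apply: eq_bigr => j _; by rewrite mulrBr.
Qed.

(** Symmetry of the weights makes the double sum equal to its opposite. *)
Lemma laplacian_colsum q (X : 'M[R]_(N, q)) k : \sum_i (L *m X) i k = 0.
Proof.
have [_ sa _] := Hundir.
under eq_bigr do rewrite mulmx_laplacian.
set s := LHS; suff : s = - s by move=> h; lra.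
rewrite {1}/s exchange_big -sumrN /=; apply: eq_bigr => i _; rewrite -sumrN.
by apply: eq_bigr => j _; rewrite sa -mulrN opprB.
Qed.

(** Pairing [L *m X] with [X] gives the Dirichlet form [\sum_i \sum_j a i j * (X i k - X j k) ^+ 2],
    which therefore vanishes. Rows of [X] agree across edges, hence along paths. *)
Lemma laplacian_ker q (X : 'M[R]_(N, q)) : L *m X = 0 ->
  forall i j k, X i k = X j k.
Proof.
have [_ sa a0] := Hundir.
move=> LX i j k.
have E : \sum_i \sum_j a i j * (X i k - X j k) ^+ 2 = 0.
  have h : \sum_i X i k * \sum_j a i j * (X i k - X j k) = 0.
    by rewrite big1// => i' _; rewrite -mulmx_laplacian LX mxE mulr0.
  have h' : \sum_i \sum_j a i j * (X i k - X j k) * X i k = 0.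
    by rewrite -[RHS]h; apply: eq_bigr => i' _; rewrite mulrC mulr_suml.
  have h2 : \sum_i \sum_j a i j * (X j k - X i k) * X j k = 0.
    rewrite -[RHS]h' exchange_big /=; apply: eq_bigr => i' _; apply: eq_bigr => j' _.
    by rewrite sa.
  have := congr2 +%R h' h2; rewrite addr0; apply: etrans.
  rewrite -big_split /=; apply: eq_bigr => i' _.
  by rewrite -big_split /=; apply: eq_bigr => j' _; ring.
have nn i' j' : 0 <= a i' j' * (X i' k - X j' k) ^+ 2 by rewrite mulr_ge0 ?sqr_ge0.
have adj i' j' : 0 < a i' j' -> X i' k = X j' k.
  move: E => /eqP; rewrite psumr_eq0; last by move=> *; exact: sumr_ge0.
  move=> /allP/(_ i' (mem_index_enum _)) /=; rewrite psumr_eq0//.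
  move=> /allP/(_ j' (mem_index_enum _)) /=; rewrite mulf_eq0 => /orP[/eqP->|].
    by rewrite ltxx.
  by rewrite sqrf_eq0 subr_eq0 => /eqP.
have /connectP[p] := Hconn i j.
elim: p i => [i _ -> //|x p IH i /= /andP[ix xp] jl].
by rewrite (adj _ _ ix); exact: IH.
Qed.

(** By symmetry [frob (L *m W) (L *m W) = frob W (L *m (L *m W))], so [L *m L] and [L] have the same
    kernel, hence the same row space. Thus [Q] inverts [L] on its range. *)
Lemma laplacian_sq : exists Q, L = Q *m L *m L.
Proof.
suff /submxP[Q LQ] : (L <= L *m L)%MS by exists Q; rewrite -mulmxA.
rewrite submxE; set W := cokermx _; apply/eqP/frob_eq0.
rewrite -(frob_mulmx_sym _ _ laplacian_sym) mulmxA mulmx_coker frob_trace.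
by rewrite mulmx0 linear0.
Qed.

(** The kernel of [L] consists of matrices with equal rows, to which the columns of [B] are
    orthogonal. So [B] is in the range of the symmetric matrix [L], which is also the range of
    [L *m L]. *)
Lemma laplacian_range q (B : 'M[R]_(N, q)) : (forall k, \sum_i B i k = 0) ->
  exists nu, L *m (L *m nu) = B.
Proof.
move=> B0; have [Q LQ] := laplacian_sq.
have LQ' : L = L *m L *m Q^T.
  by have := congr1 trmx LQ; rewrite !trmx_mul laplacian_sym mulmxA.
suff /submxP[D BD] : (B^T <= L)%MS.
  exists (Q^T *m D^T); rewrite -[RHS]trmxK BD trmx_mul laplacian_sym.
  by rewrite !mulmxA -LQ'.
rewrite submxE; apply/eqP/matrixP => l k; rewrite mxE [RHS]mxE.
set W := cokermx _; have LW : L *m W = 0 by exact: mulmx_coker.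
(* Without agents the sum is empty; otherwise [i0] indexes the common row. *)
case: (pickP 'I_N) => [i0 _|noN]; last by rewrite big1// => i; have := noN i.
under eq_bigr => i _ do rewrite mxE (laplacian_ker LW i i0).
by rewrite -mulr_suml B0 mul0r.
Qed.

End Laplacian.

(** * Differentiable strictly convex functions *)

Lemma dotE (R : realType) d (x y : 'cV[R]_d) : dot x y = frob x y.
Proof.
by rewrite /dot mxE; apply: eq_bigr => i _; rewrite big_ord1 mxE.
Qed.

Section Compactness.
Context {R : realType} (d : nat).

Lemma trmx_continuous p q : continuous (@trmx R p q).
Proof.
move=> /= A s /= /nbhs_ballP [e e0 es].
apply/nbhs_ballP; exists e => //= B [_ AB]; apply: es; split=> // i j.
by rewrite !mxE; exact: AB.
Qed.

Lemma frob_continuous (ys : 'cV[R]_d) :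
  continuous (fun x : 'cV[R]_d => frob (x - ys) (x - ys)).
Proof.
have cxy i : continuous (fun x : 'cV[R]_d => (x - ys) i 0).
  move=> x; rewrite (_ : (fun x => _) = (fun x : 'cV[R]_d => x i 0 - ys i 0)).
    by apply: continuousB; [exact: coord_continuous|exact: cst_continuous].
  by apply/funext => y; rewrite !mxE.
rewrite (_ : (fun x => _) =
    (fun x : 'cV[R]_d => \sum_i (x - ys) i 0 * (x - ys) i 0)); last first.
  by apply/funext => x; apply: eq_bigr => i _; rewrite big_ord1.
apply: continuous_big => [|i _ x]; first exact: add_continuous.
by apply: continuousM; exact: cxy.
Qed.

(** Domain of the extreme value arguments below: a positive [b] keeps it away from [ys], and [b = 0]
    gives a ball. *)
Lemma compact_shell (ys : 'cV[R]_d) (b M : R) :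
  compact [set x : 'cV[R]_d | b <= frob (x - ys) (x - ys) <= M].
Proof.
set A := [set x | _].
(* [bounded_closed_compact] concerns row vectors, so the shell is viewed as the image of its
   transpose. *)
have -> : A = trmx @` (trmx @^-1` A).
  apply/seteqP; split=> [x Ax|_ [x Ax <-]//].
  by exists x^T; rewrite ?trmxK//= trmxK.
apply: continuous_compact.
  exact/continuous_subspaceT/trmx_continuous.
apply: bounded_closed_compact.
  exists (`|ys| + Num.sqrt `|M|); split; first by rewrite num_real.
  move=> r rM x /= /andP[_ xM]; apply: le_trans (ltW rM).
  rewrite [leLHS]/Num.Def.normr/= mx_normrE; apply: bigmax_le => [|[i j] _ /=].
    by rewrite addr_ge0// sqrtr_ge0.
  rewrite (_ : x i j = ys j 0 + (x^T - ys) j 0); last by rewrite !mxE ord1; ring.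
  apply: le_trans (ler_normD _ _) _; apply: lerD.
    rewrite [leRHS]/Num.Def.normr/= mx_normrE.
    exact: (le_bigmax _ (fun ij => `|ys ij.1 ij.2|) (j, 0)).
  rewrite -sqrtr_sqr ler_wsqrtr// (le_trans (frob_entry _ _ _))//.
  by rewrite (le_trans xM)// ler_norm.
apply: preimage_closed; first by move=> x _; exact: trmx_continuous.
have -> : A = (fun x : 'cV[R]_d => frob (x - ys) (x - ys)) @^-1` `[b, M].
  by apply/seteqP; split=> x /=; rewrite in_itv.
by apply: preimage_closed; [move=> x _; exact: frob_continuous|exact: itv_closed].
Qed.

End Compactness.

Section Convex.
Context {R : realType} (d : nat) (g : 'cV[R]_d -> R) (ys : 'cV[R]_d).
Hypothesis Hdiff : forall y, differentiable (g : 'cV[R]_d -> R^o) y.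
Hypothesis Hconv : strictly_convex g.

(* Bounding the dissipation below by the Bregman divergence avoids any use of
   the continuity of the gradient. *)
Let bregman z := g z - g ys - dot (grad g ys) (z - ys).

(** The gap is the Bregman divergence with [z] and [ys] exchanged, nonnegative by convexity. *)
Lemma bregman_le_dot z : bregman z <= dot (grad g z - grad g ys) (z - ys).
Proof.
have [->|zys] := eqVneq z ys.
  by rewrite /bregman !subrr !dotE !frob_trace !mulmx0 linear0 subr0.
rewrite eq_sym in zys.
have := Hconv zys; rewrite /bregman !dotE frobBl -(opprB z ys) frobNr => h.
by lra.
Qed.

Lemma bregman_ge0 z : 0 <= bregman z.
Proof.
have [->|zys] := eqVneq z ys.
  by rewrite /bregman !subrr !dotE !frob_trace !mulmx0 linear0 subr0.
by have := Hconv zys; rewrite /bregman subr_ge0; exact: ltW.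
Qed.

Let g_continuous : continuous g.
Proof. by move=> x; exact/differentiable_continuous/Hdiff. Qed.

(** The continuous function [bregman] attains its minimum on the compact shell, and the minimum is
    positive because the shell excludes [ys]. *)
Lemma bregman_lower_bound b M : 0 < b ->
  exists2 mu, 0 < mu &
    forall z, b <= frob (z - ys) (z - ys) <= M -> mu <= bregman z.
Proof.
move=> b0; set A := [set z : 'cV[R]_d | b <= frob (z - ys) (z - ys) <= M].
have [A0|/set0P A0] := eqVneq A set0.
  by exists 1 => // z Az; have : A z by []; rewrite A0.
have cdot : continuous (fun z : 'cV[R]_d => dot (grad g ys) (z - ys)).
  rewrite (_ : (fun z => _) = fun z : 'cV[R]_d =>
      \sum_i (grad g ys i 0 : R) * (z i 0 - ys i 0)).
    apply: (continuous_big (P := xpredT)) => [|i _]; first exact: add_continuous.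
    move: (grad g ys i 0) => c x.
    have cz : {for x, continuous (fun z : 'cV[R]_d => z i 0 - ys i 0)}.
      by apply: continuousB; [exact: coord_continuous|exact: cst_continuous].
    exact: (continuous_comp cz (@mulrl_continuous R c _)).
  apply/funext => y; rewrite dotE; apply: eq_bigr => i _.
  by rewrite big_ord1 !mxE.
have cD : continuous bregman.
  move=> z; apply: (@continuousB _ _ _ (fun z : 'cV[R]_d => g z - g ys)).
    by apply: continuousB; [exact: g_continuous|exact: cst_continuous].
  exact: cdot.
have [z /set_mem /= /andP[bz _] Hz] := compact_EVT_min A0 (@compact_shell _ _ ys b M)
  (continuous_subspaceT cD).
exists (bregman z); last by move=> y yA; apply: Hz; exact/mem_set.
rewrite /bregman subr_gt0; apply: Hconv; apply: contraTneq bz => ->.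
by rewrite subrr frob_trace mulmx0 linear0 -ltNge.
Qed.

(** The convexity inequality at [z] with the steps [ek] and [- ek] bounds each partial derivative by
    an increment of [g], and [g] is bounded on a larger ball. *)
Lemma grad_bounded M :
  exists K, forall z, frob (z - ys) (z - ys) <= M -> forall k, `|grad g z k 0| <= K.
Proof.
(* The squared radius leaves room for a unit step: [|w + e|^2 <= 2 |w|^2 + 2 |e|^2]. *)
pose A := [set z : 'cV[R]_d | 0 <= frob (z - ys) (z - ys) <= 2 * (`|M| + 1)].
have A0 : A !=set0.
  exists ys; rewrite /A /= subrr frob_trace mulmx0 linear0 lexx /=.
  by rewrite mulr_ge0// addr_ge0.
have cg : continuous (fun z : 'cV[R]_d => `|g z|).
  by move=> z; exact: (continuous_comp (@g_continuous z) (@norm_continuous _ R^o (g z))).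
have [c _ Hc] := compact_EVT_max A0 (@compact_shell _ _ ys 0 (2 * (`|M| + 1)))
  (continuous_subspaceT cg).
exists (2 * `|g c|) => z zM k.
have zA e : frob e e <= 1 -> `|g (z + e)| <= `|g c|.
  move=> e1; apply: Hc; apply/mem_set; rewrite /A /= frob_ge0 /=.
  rewrite addrAC; move: (z - ys) zM => w wM; rewrite frobDr !frobDl (frobC e).
  have := frob_young w e; have := ler_norm (frob w e).
  by have := ler_norm M; lra.
pose ek : 'cV[R]_d := delta_mx k 0.
have ek0 : ek != 0.
  by apply/eqP => /matrixP/(_ k 0); rewrite !mxE !eqxx => /eqP; rewrite oner_eq0.
have fek (x : 'cV[R]_d) : frob x ek = x k 0.
  rewrite /frob (bigD1 k)//= big_ord1 !mxE !eqxx mulr1 big1 ?addr0// => j jk.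
  by rewrite big_ord1 !mxE (negPf jk) mulr0.
have h (e : 'cV[R]_d) : e != 0 -> frob e e <= 1 -> frob (grad g z) e <= 2 * `|g c|.
  move=> e0 e1; have : z + e != z by rewrite -subr_eq0 addrC addKr.
  move=> /Hconv; rewrite dotE [z + e - z]addrC addKr => h.
  have := zA _ e1; have := zA 0; rewrite addr0 frob_trace mulmx0 linear0 => /(_ ler01).
  have := ler_norm (g (z + e)); have := ler_norm (- g z); rewrite normrN.
  lra.
rewrite ler_norml; apply/andP; split.
  have := h (- ek); rewrite oppr_eq0 !frobNr -fek => /(_ ek0).
  by rewrite frobC frobNr opprK fek mxE !eqxx => /(_ (lexx _)); lra.
by rewrite -fek; apply: h => //; rewrite fek mxE !eqxx.
Qed.

End Convex.

Section Minimizer.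
Context {R : realType} (d : nat).

(** The derivative is also the limit from the right, where the difference quotients at a minimizer
    are nonnegative. *)
Lemma derive_ge0_minimizer (F : 'cV[R]_d -> R^o) x v :
  derivable F x v -> minimizer F x -> 0 <= 'D_v F x.
Proof.
move=> dF mF; rewrite /derive.
rewrite cvg_at_rightE; last exact: dF.
apply: limr_ge.
  rewrite -(cvg_at_rightE (fun h : R => h^-1 *: ((F \o shift x) (h *: v) - F x))) //.
  apply: cvg_trans dF; apply: cvg_app => A [e e0 Ae].
  by exists e => // h he h0; apply: Ae => //; exact/lt0r_neq0.
near=> h; rewrite /= /GRing.scale /= mulr_ge0 ?subr_ge0//.
rewrite invr_ge0; near: h.
exact: nbhs_right_ge.
Unshelve. all: by end_near. Qed.

Lemma sum_grad_minimizer N (f : 'I_N -> 'cV[R]_d -> R) x :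
  (forall i y, differentiable (f i : 'cV[R]_d -> R^o) y) ->
  minimizer (fun y => \sum_i f i y) x -> \sum_i grad (f i) x = 0.
Proof.
move=> df mf; pose F : 'cV[R]_d -> R^o := \sum_i (f i : 'cV[R]_d -> R^o).
have FE : F = (fun y => \sum_i f i y) by apply/funext => y; rewrite /F fct_sumE.
have dF y : differentiable F y by apply: differentiable_sum => i; exact: df.
have mF : minimizer F x by rewrite FE.
(* The derivative is linear in the direction and nonnegative along both [v] and [- v]. *)
have F0 v : 'D_v F x = 0.
  apply/eqP; rewrite eq_le derive_ge0_minimizer ?andbT//; last exact: diff_derivable.
  have := derive_ge0_minimizer (@diff_derivable _ _ _ _ _ (- v) (dF x)) mF.
  by rewrite !deriveE// linearN oppr_ge0.
apply/matrixP => k j; rewrite ord1 summxE [RHS]mxE -[RHS](F0 (delta_mx k 0)).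
rewrite derive_sum; last by move=> i; exact: diff_derivable.
by apply: eq_bigr => i _; rewrite mxE.
Qed.

End Minimizer.

(** * Saddle-point dynamics *)

(** If [q t > e], the growth bound [K] forces [q >= e / 2] during the preceding time
    [tau = e / 2 / K], in which [V] loses at least [mu * tau]. This is impossible once [V] is within
    [mu * tau] of its infimum, which holds from [s] on. *)
Lemma vanishing_of_dissipation (R : realType) (V dV q dq : R -> R) (K : R) :
  @solution_on R R^o +oo%E V dV -> @solution_on R R^o +oo%E q dq ->
  (forall t, 0 <= V t) -> (forall t, 0 < t -> dV t <= 0) -> 0 < K ->
  (forall t, 0 < t -> dq t <= K) ->
  (forall b, 0 < b -> exists2 mu, 0 < mu &
     forall t, 0 < t -> b <= q t -> dV t <= - mu) ->
  is_vanishing_signal q.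
Proof.
move=> sV sq V0 dV0 K0 dqK H e e0.
have e2 : 0 < e / 2 by rewrite divr_gt0.
have [mu mu0 Hmu] := H _ e2; pose tau := e / 2 / K.
have tau0 : 0 < tau by rewrite divr_gt0.
pose E := V @` [set t | 0 <= t].
have hE : has_inf E.
  by split; [exists (V 0); exists 0 => /=|exists 0 => _ [t _ <-]].
have [_ [s /= s0 <-] Vs] := inf_adherent (mulr_gt0 mu0 tau0) hE.
exists (s + tau) => [|t st]; first by rewrite addr_ge0// ltW.
rewrite leNgt; apply/negP => qt.
have s't : s <= t - tau by rewrite lerBrDr.
have t't : t - tau <= t by rewrite gerBl ltW.
have t'0 := le_trans s0 s't.
have qu u : t - tau < u -> u <= t -> e / 2 <= q u.
  move=> tu ut; have u0 : 0 < u by exact: le_lt_trans tu.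
  have qK v : u < v -> v < t -> dq v <= K.
    by move=> uv _; apply: dqK; exact: lt_trans uv.
  have := sol_growth sq (ltW u0) ut (ltry _) qK.
  have : K * (t - u) <= K * tau by rewrite ler_wpM2l ?(ltW K0)//; lra.
  by rewrite [K * tau]mulrC /tau divfK ?gt_eqF//; lra.
have : V t - V (t - tau) <= - mu * (t - (t - tau)).
  apply: (sol_growth sV t'0 t't (ltry _)) => u tu ut.
  by apply: Hmu; [exact: le_lt_trans tu|exact/qu/ltW].
have : V (t - tau) <= V s.
  apply: (sol_nonincreasing sV s0 s't (ltry _)) => u su _; apply: dV0.
  exact: le_lt_trans su.
rewrite (_ : t - (t - tau) = tau); last by ring.
have : inf E <= V t by apply: ge_inf; [exact: hE.2|exists t => //=; exact: le_trans t't].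
by lra.
Qed.

(** * Energy estimates for the saddle-point flow in error coordinates *)

Section SaddleErrorSystem.
Context {R : realType} (T : \bar R) (N m : nat) (L : 'M[R]_N).
Variables Z La G : R -> 'M[R]_(N, m).
Hypothesis symL : L^T = L.
Hypothesis solZe : forall i j, @solution_on R R^o T (fun t => Z t i j)
  (fun t => (- G t - L *m La t) i j).
Hypothesis solLa : forall i j, @solution_on R R^o T (fun t => La t i j)
  (fun t => (L *m Z t) i j).

Let V t := (frob (Z t) (Z t) + frob (La t) (La t)) / 2.

Let V_ge0 t : 0 <= V t.
Proof. by rewrite divr_ge0// addr_ge0// frob_ge0. Qed.

(** The coupling terms [- frob Z (L La)] and [frob La (L Z)] cancel because [L] is symmetric. *)
Lemma sol_saddle_energy :
  @solution_on R R^o T V (fun t => - frob (Z t) (G t)).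
Proof.
have := solZ 2^-1 (solD (sol_frob solZe solZe) (sol_frob solLa solLa)).
rewrite (_ : (fun t => _ * _) = V); last by apply/funext => t; rewrite mulrC.
congr solution_on; apply/funext => t.
rewrite (frobC (- G t - _)) (frobC (L *m Z t)) frobBr frobNr.
rewrite (frobC (La t) (L *m Z t)) -(frob_mulmx_sym _ _ symL).
by field.
Qed.

Lemma saddle_bounded :
  (forall t, 0 < t -> (t%:E < T)%E -> 0 <= frob (Z t) (G t)) ->
  is_bounded_signal T (fun t => frob (Z t) (Z t) + frob (La t) (La t)).
Proof.
move=> H; exists (2 * V 0) => t t0 tT.
have : V t <= V 0.
  apply: (sol_nonincreasing sol_saddle_energy (lexx 0) t0 tT) => u u0 uT.
  by rewrite oppr_le0 H.
by rewrite /V; lra.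
Qed.

Let frob_mulL : exists2 k, 1 <= k &
  forall X : 'M[R]_(N, m), frob (L *m X) (L *m X) <= k * frob X X.
Proof. exact: frob_mulmx_le. Qed.

Lemma saddle_vanishing : T = +oo%E ->
  (forall t, 0 < t -> 0 <= frob (Z t) (G t)) ->
  (exists K, forall t, 0 < t -> frob (G t) (G t) <= K) ->
  (forall b, 0 < b -> exists2 mu, 0 < mu &
     forall t, 0 < t -> b <= frob (Z t) (Z t) -> mu <= frob (Z t) (G t)) ->
  is_vanishing_signal (fun t => frob (Z t) (Z t)).
Proof.
move=> Too H0 [K GK] Hmu.
have [M VM] := saddle_bounded (fun t t0 _ => H0 t t0).
have [k k1 Lk] := frob_mulL.
have sV := sol_saddle_energy; have sq := sol_frob solZe solZe.
rewrite Too in sV sq VM.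
have k0 : 0 <= k by lra.
have M0 : 0 <= M.
  by apply: le_trans (VM 0 (lexx _) (ltry _)); rewrite addr_ge0// frob_ge0.
have K0 : 0 <= K by apply: le_trans (GK 1 ltr01); rewrite frob_ge0.
have kM0 : 0 <= k * M by rewrite mulr_ge0.
(* Young's inequality bounds the derivative of [frob Z Z] by [2 |Z|^2 + |G|^2 + |L La|^2], hence by
   [2 * M + K + k * M]; the added 1 makes the constant positive. *)
apply: (vanishing_of_dissipation (K := 2 * M + K + k * M + 1) sV sq V_ge0).
- by move=> t t0; rewrite oppr_le0 H0.
- by lra.
- move=> t t0; rewrite (frobC (- G t - _)) frobBr frobNr.
  have := frob_young (Z t) (G t); have := frob_young (Z t) (L *m La t).
  have := ler_norm (- frob (Z t) (G t)); have := ler_norm (- frob (Z t) (L *m La t)).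
  rewrite !normrN; have := GK t t0; have := VM t (ltW t0) (ltry _).
  have := frob_ge0 (La t); have := frob_ge0 (Z t); have := Lk (La t).
  move=> h1 h2 h3 h4.
  have : k * frob (La t) (La t) <= k * M by rewrite ler_wpM2l//; lra.
  by lra.
- move=> b b0; have [mu mu0 h] := Hmu b b0; exists mu => // t t0 bt.
  by rewrite lerN2 h.
Qed.

(** The energy does not dissipate [La], but the derivative of the cross term [frob Z (L La)]
    contains [- |L La|^2], which controls [|La|^2] through [Q]. *)
Lemma saddle_exp_vanishing omega theta (Q : 'M[R]_N) : T = +oo%E ->
  0 < omega ->
  (forall t, 0 < t -> omega * frob (Z t) (Z t) <= frob (Z t) (G t)) ->
  (forall t, 0 < t -> frob (G t) (G t) <= theta * frob (Z t) (Z t)) ->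
  0 <= theta ->
  (forall t, 0 < t -> La t = Q *m (L *m La t)) ->
  is_exp_vanishing_signal (fun t => frob (Z t) (Z t)).
Proof.
move=> Too om0 HZG HG th0 HQ.
have [k k1 Lk] := frob_mulL.
have [q q1 Qq] := frob_mulmx_le m Q.
have k0 : 0 < k by lra.
have q0 : 0 < q by lra.
pose k' := theta + k.
have k'0 : 0 < k' by rewrite /k'; lra.
(* The bound [del * k' <= omega / 2] lets the dissipation of [Z] absorb the terms in [Z] created by
   the cross term; [del * k <= 1 / 2] keeps [W] between [V / 2] and [2 * V]. *)
pose del := Num.min (omega / (2 * k')) (2 * k)^-1.
have del0 : 0 < del by rewrite lt_min divr_gt0 ?invr_gt0 ?mulr_gt0.
have del1 : del * k' <= omega / 2.
  have : del <= omega / (2 * k') by rewrite ge_min lexx.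
  by rewrite ler_pdivlMr ?mulr_gt0//; lra.
have del2 : del * k <= 1 / 2.
  have : del <= (2 * k)^-1 by rewrite ge_min lexx orbT.
  by rewrite -[(2 * k)^-1]mul1r ler_pdivlMr ?mulr_gt0//; lra.
have del3 : del <= 1 / 2.
  by apply: le_trans del2; rewrite ler_peMr// ltW.
pose W t := V t + del * frob (Z t) (L *m La t).
have sW : @solution_on R R^o +oo%E W (fun t => - frob (Z t) (G t) +
    del * (frob (- G t - L *m La t) (L *m La t) + frob (Z t) (L *m (L *m Z t)))).
  rewrite -Too; apply: solD sol_saddle_energy (solZ _ _).
  exact: sol_frob solZe (sol_mulmx _ solLa).
have cross t : del * `|frob (Z t) (L *m La t)| <= V t / 2.
  have h1 := frob_young (Z t) (L *m La t); have h2 := Lk (La t).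
  have h3 : del * (2 * `|frob (Z t) (L *m La t)|) <=
      del * (frob (Z t) (Z t)) + del * (k * frob (La t) (La t)).
    by rewrite -mulrDr ler_wpM2l ?(ltW del0)//; lra.
  have h4 : del * frob (Z t) (Z t) <= 1 / 2 * frob (Z t) (Z t).
    by rewrite ler_wpM2r// frob_ge0.
  have h5 : del * k * frob (La t) (La t) <= 1 / 2 * frob (La t) (La t).
    by rewrite ler_wpM2r// frob_ge0.
  by rewrite /V; lra.
have W_ge t : V t / 2 <= W t.
  have := cross t; have : - (del * `|frob (Z t) (L *m La t)|) <=
      del * frob (Z t) (L *m La t).
    by rewrite -mulrN ler_wpM2l ?(ltW del0)// lerNl -normrN ler_norm.
  by rewrite /W; lra.
have W_le t : W t <= 2 * V t.
  have := cross t; have : del * frob (Z t) (L *m La t) <=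
      del * `|frob (Z t) (L *m La t)|.
    by rewrite ler_wpM2l ?(ltW del0)// ler_norm.
  by have := V_ge0 t; rewrite /W; lra.
(* Decay rate of [W]: [gam * (2 * V)] splits into a [Z] part covered by [omega / 2] and an [La] part
   covered by [del / 2] times [|L La|^2]. *)
pose gam := Num.min (omega / 2) (del / (2 * q)).
have gam0 : 0 < gam by rewrite lt_min !divr_gt0// mulr_gt0.
have gam1 : gam <= omega / 2 by rewrite ge_min lexx.
have gam2 : gam * q <= del / 2.
  have : gam <= del / (2 * q) by rewrite ge_min lexx orbT.
  by rewrite ler_pdivlMr ?mulr_gt0//; lra.
have EE := exp_vanishing_signal_class (R := R).
apply: (signal_le EE (k := 4) (q := W)) => // [t _ _|].
  have := W_ge t; have := frob_ge0 (La t); rewrite /V; lra.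
apply: (signal_filter EE gam0 sW (q := fun=> 0)) => // [t|t t0 _|].
- by apply: le_trans (W_ge t); rewrite divr_ge0.
- rewrite addr0 (frobC (- G t - _)) frobBr frobNr (frob_mulmx_sym (Z t) _ symL).
  have h1 := HZG t t0; have h2 := HG t t0; have h3 := Lk (Z t).
  (* This use of Young's inequality spends half of the gain [|L La|^2]. *)
  have h4 := frob_young (L *m La t) (G t).
  have h5 := ler_norm (- frob (L *m La t) (G t)); rewrite normrN in h5.
  have h6 : frob (La t) (La t) <= q * frob (L *m La t) (L *m La t).
    by rewrite {1 2}(HQ t t0).
  have h7 : gam * frob (La t) (La t) <= del / 2 * frob (L *m La t) (L *m La t).
    apply: le_trans (_ : _ <= gam * (q * frob (L *m La t) (L *m La t))) _.
      by rewrite ler_wpM2l// ltW.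
    by rewrite mulrA ler_wpM2r// frob_ge0.
  have h8 : gam * frob (Z t) (Z t) <= omega / 2 * frob (Z t) (Z t).
    by rewrite ler_wpM2r// frob_ge0.
  have h9 : del * k' * frob (Z t) (Z t) <= omega / 2 * frob (Z t) (Z t).
    by rewrite ler_wpM2r// frob_ge0.
  have h10 : gam * W t <= gam * (2 * V t) by rewrite ler_wpM2l ?W_le// ltW.
  have h11 : del * (- frob (L *m La t) (G t) - frob (L *m La t) (L *m La t) +
      frob (L *m Z t) (L *m Z t)) <= del * (k' * frob (Z t) (Z t) -
      frob (L *m La t) (L *m La t) / 2).
    have h12 : 0 <= theta * frob (Z t) (Z t) by rewrite mulr_ge0// frob_ge0.
    by rewrite ler_wpM2l ?(ltW del0)// /k'; lra.
  move: h10; rewrite /V; lra.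
- exact: signal_0 EE.
Qed.

End SaddleErrorSystem.

(** One row per agent, so that the Laplacian acts by left multiplication. *)
Definition stack (R : realType) N m (x : 'I_N -> 'cV[R]_m) : 'M[R]_(N, m) :=
  \matrix_(i, k) x i k 0.

Lemma frob_stack (R : realType) N m (x y : 'I_N -> 'cV[R]_m) :
  frob (stack x) (stack y) = \sum_i dot (x i) (y i).
Proof.
apply: eq_bigr => i _; rewrite dotE; apply: eq_bigr => k _.
by rewrite big_ord1 !mxE.
Qed.

(** * The saddle-point flow of the agents *)

Section SaddleDynamics.
Context {R : realType} (T : \bar R) (N m : nat) (a : 'M[R]_N)
  (f : 'I_N -> 'cV[R]_m -> R) (ystar : 'cV[R]_m).
Hypothesis Hundir : undirected_graph a.
Hypothesis Hconn : connected_graph a.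
Hypothesis Hdiff : forall i y, differentiable (f i : 'cV[R]_m -> R^o) y.
Hypothesis Hconvex : forall i, strictly_convex (f i).
Hypothesis Hmin : minimizer (fun y => \sum_i f i y) ystar.
Variables z lam : 'I_N -> R -> 'cV[R]_m.
Hypothesis solz : forall i, solution_on T (z i) (fun t =>
  - grad (f i) (z i t) - \sum_j a i j *: (lam i t - lam j t)).
Hypothesis sollam : forall i, solution_on T (lam i) (fun t =>
  \sum_j a i j *: (z i t - z j t)).

Let L := laplacian a.
Let Z t := stack (fun i => z i t - ystar).
Let G t := stack (fun i => grad (f i) (z i t) - grad (f i) ystar).

(* The multiplier ls is chosen with lambda(0) - ls in the range of L, which is
   invariant under the flow; Q is an inverse of L on this range. *)
Lemma saddle_error_coordinates : exists (La : R -> 'M[R]_(N, m)) (Q : 'M[R]_N),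
  [/\ forall i j, @solution_on R R^o T (fun t => Z t i j)
        (fun t => (- G t - L *m La t) i j),
      forall i j, @solution_on R R^o T (fun t => La t i j)
        (fun t => (L *m Z t) i j) &
      forall t, 0 < t -> (t%:E < T)%E -> La t = Q *m (L *m La t)].
Proof.
have symL := laplacian_sym Hundir.
pose La0 := stack (fun i => lam i 0).
pose Gs := stack (fun i => grad (f i) ystar).
(* Solvable because the gradients at the minimizer sum to 0, as do the entries of each column of
   [L *m La0]. *)
have [nu Lnu] : exists nu, L *m (L *m nu) = Gs + L *m La0.
  apply: (laplacian_range Hundir Hconn) => k.
  under eq_bigr do rewrite mxE; rewrite big_split /= laplacian_colsum// addr0.
  have /matrixP/(_ k 0) := sum_grad_minimizer Hdiff Hmin.
  by rewrite summxE [RHS]mxE => h; rewrite -[RHS]h; apply: eq_bigr => i _; rewrite mxE.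
have [Q LQ] := laplacian_sq Hundir.
(* The multiplier is [La0 - L *m nu]: [L] maps it to [- Gs], and the initial error [La 0 = L *m nu]
   is in the range of [L]. *)
pose La t := stack (fun i => lam i t) - (La0 - L *m nu).
have LLa t : L *m La t = L *m stack (fun i => lam i t) + Gs.
  by rewrite /La !mulmxBr Lnu opprB addrK.
have sLa i j : @solution_on R R^o T (fun t => La t i j) (fun t => (L *m Z t) i j).
  have := solB (sol_entry j 0 (sollam i)) (sol_cst _ ((La0 - L *m nu) i j)).
  rewrite (_ : (fun t => _ - _) = (fun t => La t i j)); last first.
    by apply/funext => t; rewrite /La [RHS]mxE [X in _ = X + _]mxE [X in _ = _ + X]mxE.
  congr solution_on; apply/funext => t; rewrite subr0 summxE mulmx_laplacian.
  by apply: eq_bigr => l _; rewrite !mxE; congr (_ * _); ring.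
exists La, Q; split=> // [i j|t t0 tT].
  have := solB (sol_entry j 0 (solz i)) (sol_cst _ (ystar j 0)).
  rewrite (_ : (fun t => _ - _) = (fun t => Z t i j)); last first.
    by apply/funext => t; rewrite !mxE.
  congr solution_on; apply/funext => t; rewrite subr0 LLa !mxE summxE.
  have := mulmx_laplacian a (stack (fun i => lam i t)) i j; rewrite mxE => ->.
  rewrite (eq_bigr (fun l => a i l * (stack (fun i => lam i t) i j -
    stack (fun i => lam i t) l j))); last by move=> l _; rewrite !mxE.
  by ring.
(* The defect [D] of the last claim is constant, as [Q *m L *m L = L], and vanishes at time 0. *)
pose D t := (1%:M - Q *m L) *m La t.
have sD i j : @solution_on R R^o T (fun t => D t i j) (fun=> 0).
  have := sol_mulmx (1%:M - Q *m L) sLa i j; congr solution_on; apply/funext => u.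
  by rewrite mulmxA mulmxBl mul1mx -LQ subrr mul0mx mxE.
have D0 : D 0 = 0.
  by rewrite /D /La /La0 subKr mulmxA mulmxBl mul1mx -LQ subrr mul0mx.
apply/eqP; rewrite -subr_eq0 mulmxA -[X in X - _]mul1mx -mulmxBl -/(D t).
apply/eqP/matrixP => i j; rewrite [RHS]mxE.
have D0ij : D 0 i j = 0 by rewrite D0 mxE.
apply/eqP; rewrite eq_le; apply/andP; split.
  by rewrite -D0ij; apply: (sol_nonincreasing (sD i j) (lexx 0) (ltW t0) tT).
have := sol_nonincreasing (solZ (-1) (sD i j)) (lexx 0) (ltW t0) tT.
by rewrite D0ij mulr0 mulN1r oppr_le0; apply.
Qed.

Let dotZG t : \sum_i dot (z i t - ystar) (grad (f i) (z i t) - grad (f i) ystar) =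
  frob (Z t) (G t).
Proof. by rewrite frob_stack. Qed.

Let ZG_ge0 t : 0 <= frob (Z t) (G t).
Proof.
rewrite -dotZG sumr_ge0// => i _; rewrite dotE frobC -dotE.
apply: le_trans (bregman_le_dot _ (Hconvex i) _); exact: bregman_ge0.
Qed.

Let entry_signal P i k : signal_class T P -> P (fun t => frob (Z t) (Z t)) ->
  P (fun t => (z i t k 0 - ystar k 0) ^+ 2).
Proof.
move=> PP; apply: (signal_le PP ler01) => t _ _; rewrite mul1r.
by have := frob_entry (Z t) i k; rewrite !mxE.
Qed.

Let Z_bounded : is_bounded_signal T (fun t => frob (Z t) (Z t)).
Proof.
have [La [Q [sZ sL _]]] := saddle_error_coordinates.
have BB := bounded_signal_class T; have symL := laplacian_sym Hundir.
apply: (signal_le BB ler01) (saddle_bounded symL sZ sL (fun t _ _ => ZG_ge0 t)).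
by move=> t _ _; rewrite mul1r lerDl frob_ge0.
Qed.

Lemma saddle_dynamics_bounded i k :
  is_bounded_signal T (fun t => (z i t k 0 - ystar k 0) ^+ 2).
Proof. exact: entry_signal (bounded_signal_class T) Z_bounded. Qed.

Let dotZ_le t i : frob (z i t - ystar) (z i t - ystar) <= frob (Z t) (Z t).
Proof.
rewrite frob_stack (bigD1 i)//= dotE lerDl sumr_ge0// => j _.
by rewrite dotE frob_ge0.
Qed.

Lemma saddle_dynamics_vanishing i k : T = +oo%E ->
  is_vanishing_signal (fun t => (z i t k 0 - ystar k 0) ^+ 2).
Proof.
move=> Too; apply: (@entry_signal (@is_vanishing_signal R)).
  by rewrite Too; exact: vanishing_signal_class.
have [La [Q [sZ sL _]]] := saddle_error_coordinates.
have [M ZM] := Z_bounded.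
apply: (saddle_vanishing (laplacian_sym Hundir) sZ sL Too) => //.
  (* The trajectory stays in a ball, on which the gradients are bounded. *)
  have /choice[K HK] i' := grad_bounded ystar (@Hdiff i') (Hconvex i') M.
  exists (\sum_(i' < N) \sum_(k' < m) (K i' + `|grad (f i') ystar k' 0|) ^+ 2) => t t0.
  apply: ler_sum => i' _; apply: ler_sum => k' _; rewrite -expr2 !mxE.
  rewrite -real_normK ?num_real// ler_sqr ?nnegrE//.
    apply: le_trans (ler_normB _ _) _; rewrite lerD2r; have := HK i' (z i' t).
    move=> /(_ _ k'); rewrite mxE; apply.
    by apply: le_trans (dotZ_le _ _) _; apply: ZM; rewrite ?Too ?ltW ?ltry.
  rewrite addr_ge0//; apply: le_trans (HK i' (z i' t) _ k') => //.
  by apply: le_trans (dotZ_le _ _) _; apply: ZM; rewrite ?Too ?ltW ?ltry.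
(* If [|Z|^2 >= b], some agent has squared error at least [b']; dividing by [N.+1] also covers
   [N = 0] and gives the strict inequality for the contradiction. *)
move=> b b0; pose b' := b / N.+1%:R.
have b'0 : 0 < b' by rewrite divr_gt0.
have /choice[mu Hmu] i' : exists mu, 0 < mu /\ forall y,
    b' <= frob (y - ystar) (y - ystar) <= M ->
    mu <= f i' y - f i' ystar - dot (grad (f i') ystar) (y - ystar).
  by have [mu] := bregman_lower_bound ystar (@Hdiff i') (Hconvex i') M b'0; exists mu.
(* The agent that is far from [ystar] depends on [t], hence a minimum over all agents. *)
exists (\big[Num.min/1]_i' mu i').
  by apply: lt_bigmin => [|i' _]; [exact: ltr01|]; have [] := Hmu i'.
move=> t t0 bt.
have [i' bi'] : exists i', b' <= frob (z i' t - ystar) (z i' t - ystar).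
  apply/not_existsP => H; have : frob (Z t) (Z t) <= \sum_(i' < N) b'.
    rewrite frob_stack; apply: ler_sum => i' _; rewrite dotE leNgt; apply/negP => h.
    by apply: (H i'); exact: ltW.
  rewrite sumr_const card_ord -mulr_natr => h.
  have : b' * N.+1%:R <= b' * N%:R by rewrite /b' divfK//; exact: le_trans h.
  by rewrite ler_pM2l// ler_nat ltnn.
apply: le_trans (bigmin_le _ i' _) _; rewrite -dotZG (bigD1 i')//=.
have dg j : 0 <= dot (z j t - ystar) (grad (f j) (z j t) - grad (f j) ystar).
  rewrite dotE frobC -dotE; apply: le_trans (bregman_le_dot _ (Hconvex j) _).
  exact: bregman_ge0.
rewrite -[leLHS]addr0; apply: lerD; last exact: sumr_ge0.
rewrite dotE frobC -dotE; apply: le_trans (bregman_le_dot _ (Hconvex i') _).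
have [_] := Hmu i'; apply; rewrite bi' /=; apply: le_trans (dotZ_le _ _) _.
by apply: ZM; rewrite ?Too ?ltW ?ltry.
Qed.

Lemma saddle_dynamics_exp_vanishing omega theta i k : T = +oo%E ->
  0 < omega -> (forall i, strongly_convex omega (f i)) ->
  (forall i, lipschitz_grad theta (f i)) ->
  is_exp_vanishing_signal (fun t => (z i t k 0 - ystar k 0) ^+ 2).
Proof.
move=> Too om0 sc lg.
apply: (@entry_signal (@is_exp_vanishing_signal R)).
  by rewrite Too; exact: exp_vanishing_signal_class.
have [La [Q [sZ sL LaQ]]] := saddle_error_coordinates.
have enorm2 (x : 'cV[R]_m) : enorm x ^+ 2 = dot x x.
  by rewrite sqr_sqrtr// dotE frob_ge0.
apply: (saddle_exp_vanishing (laplacian_sym Hundir) sZ sL (theta := theta ^+ 2) Too om0)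
  => [t _|t _||t t0].
- rewrite -dotZG frob_stack mulr_sumr; apply: ler_sum => j _.
  by rewrite -enorm2 [leRHS]dotE frobC -dotE; exact: sc.
- rewrite !frob_stack mulr_sumr; apply: ler_sum => j _.
  rewrite -!enorm2 -exprMn; have h := lg j (z j t) ystar.
  rewrite ler_sqr ?nnegrE ?sqrtr_ge0//.
  by apply: le_trans h; exact: sqrtr_ge0.
- exact: sqr_ge0.
- by apply: LaQ => //; rewrite Too ltry.
Qed.

End SaddleDynamics.

(** * Agents in closed loop *)

Lemma signal_mulmx (R : realType) (T : \bar R) (P : (R -> R) -> Prop) p q
    (M : 'M[R]_(p, q)) (y : R -> 'cV[R]_q) i :
  signal_class T P -> (forall j, P (fun t => y t j 0 ^+ 2)) ->
  P (fun t => (M *m y t) i 0 ^+ 2).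
Proof.
move=> PP Py.
have -> : (fun t => (M *m y t) i 0 ^+ 2) =
    (fun t => sqmod (\sum_j (M i j)%:C%C * (y t j 0)%:C%C)).
  apply/funext => t; rewrite -sqmod_real mxE rmorph_sum; congr sqmod.
  by apply: eq_bigr => j _; rewrite -rmorphM.
apply: (signal_sqmod_lincomb PP (A := predT)) => j _.
by under eq_fun do rewrite sqmod_real; exact: Py.
Qed.

Section Agent.
Context {R : realType} (kappa m : nat)
    (A : 'M[R]_kappa) (B : 'M[R]_(kappa, m)) (C : 'M[R]_(m, kappa))
    (r : 'I_m -> nat)
    (psi : 'M[R]_(kappa - \sum_i r i, kappa))
    (Pi : 'M[R]_(kappa - \sum_i r i))
    (Psi : 'M[R]_(kappa - \sum_i r i, \sum_i r i))
    (Upsilon : 'M[R]_(m, kappa - \sum_i r i))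
    (S : 'M[R]_(m, \sum_i r i)).
Hypothesis Hnf : normal_form A B C psi Pi Psi Upsilon S.

Lemma chibE x s k :
  chib A C r x s k = xi A C (tagnat.sig1 s) (tagnat.sig2 s).+1 x.
Proof. by rewrite /chib mxE mxE. Qed.

(** The coordinate map is [W *m x], with [W] not square as typed. The preimages of the basis vectors
    form a right inverse [V] of [W], and injectivity makes it a left inverse. *)
Lemma normal_form_inverse :
  exists V, forall x, x = V *m col_mx (psi *m x) (chib A C r x).
Proof.
have [_ bij _] := Hnf.
pose W := col_mx psi
  (\matrix_(s < \sum_i r i) (row (tagnat.sig1 s) C *m A ^+ (tagnat.sig2 s))).
have WE x : col_mx (psi *m x) (chib A C r x) = W *m x.
  rewrite mul_col_mx; congr col_mx; apply/matrixP => s k.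
  rewrite chibE ord1 /xi /= mxE [RHS]mxE.
  by apply: eq_bigr => l _; congr (_ * _); rewrite [RHS]mxE.
have [g gK Kg] := bij.
pose V := \matrix_(j, s) g (delta_mx s 0) j 0.
have WV : W *m V = 1%:M.
  apply/matrixP => i s; have := Kg (delta_mx s 0); rewrite WE.
  move=> /matrixP/(_ i 0); rewrite [LHS]mxE [RHS]mxE eqxx andbT => h.
  rewrite [LHS]mxE [RHS]mxE -h; apply: eq_bigr => j _.
  by rewrite [V _ _]mxE.
exists V => x; apply: (bij_inj bij) => /=.
by rewrite !WE !mulmxA WV mul1mx.
Qed.

Variables (n : nat) (c : nat -> R) (eps : R).
Hypothesis Hrel : vector_relative_degree A B C r.
Hypothesis Hn : n = (\max_i r i)%N.
Hypothesis Hhurwitz : hurwitz_poly ('X^n + \poly_(k < n) c k).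
Hypothesis eps0 : 0 < eps.
Variables (T : \bar R) (x : R -> 'cV[R]_kappa) (ut zeta : R -> 'cV[R]_m)
  (w : 'I_m -> nat -> R -> R) (ystar : 'cV[R]_m).
Hypothesis solx : solution_on T x (fun t => A *m x t + B *m ut t).
Hypothesis solw : forall (j : 'I_m) (k : nat), (k < n - r j)%N ->
  @solution_on R R^o T (w j k) (w j k.+1).
Hypothesis wv : forall (j : 'I_m) (t : R), 0 <= t -> (t%:E < T)%E ->
  w j (n - r j)%N t = (- (eps ^+ n)^-1 *:
    (c 0%N *: (C *m x t - zeta t) +
     \sum_(1 <= k < n) (eps ^+ k * c k) *:
        output_derivative A C r k (x t) (fun j l => w j l t))) j 0.
Hypothesis utE : forall t : R, 0 <= t -> (t%:E < T)%E ->
  ut t = invmx (decoupling_mx A B C r) *m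
    (- (Upsilon *m (psi *m x t)) - S *m chib A C r (x t) + \col_j w j 0%N t).

(** Chain of [n] integrators behind output [i]: the first [r i] links are agent coordinates, the
    others come from the controller. *)
Let eta (i : 'I_m) k t : R :=
  if (k < r i)%N then xi A C i k.+1 (x t) else w i (k - r i)%N t.

Let r_gt0 i : (0 < r i)%N. Proof. by have [] := Hrel. Qed.

Let r_le i : (r i <= n)%N.
Proof. by rewrite Hn; exact: (leq_bigmax i). Qed.

Let n_gt0 (i : 'I_m) : (0 < n)%N.
Proof. exact: leq_trans (r_gt0 i) (r_le i). Qed.

Let solxi i k : @solution_on R R^o T (fun t => xi A C i k (x t))
  (fun t => xi A C i k (A *m x t + B *m ut t)).
Proof. by apply: sol_mulmx => j l; exact: sol_entry. Qed.

(** Below the junction this is the normal form; at [k.+1 = r i] the feedback cancels the drift and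
    leaves [w i 0]; beyond it are the controller's own integrators. *)
Let sol_eta i k : (k < n)%N -> @solution_on R R^o T (eta i k) (eta i k.+1).
Proof.
move=> kn; have [_ _ nf] := Hnf.
have [kr|rk] := ltnP k (r i).
  have -> : eta i k = (fun t => xi A C i k.+1 (x t)).
    by apply/funext => t; rewrite /eta kr.
  apply: sol_eqr (solxi i k.+1) => t t0 tT.
  have [_ nf1 nf2] := nf (x t) (ut t).
  rewrite /eta; case: ltnP => kr'; first by rewrite nf1.
  have ri : r i = k.+1 by apply/eqP; rewrite eqn_leq kr' kr.
  rewrite -ri nf2 subnn utE// 1?ltW//.
  have -> : row i C *m A ^+ (r i).-1 *m B = row i (decoupling_mx A B C r).
    by rewrite /decoupling_mx rowK.
  have [_ _ uD] := Hrel.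
  rewrite -!row_mul mulKVmx//; move: (Upsilon *m _) (S *m _) => u1 u2.
  by rewrite !mxE; ring.
have -> : eta i k = w i (k - r i)%N.
  by apply/funext => t; rewrite /eta ltnNge rk.
have -> : eta i k.+1 = w i (k - r i).+1.
  by apply/funext => t; rewrite /eta ltnNge (leqW rk) /= subSn.
by apply: solw; rewrite ltn_sub2r// (leq_ltn_trans rk).
Qed.

Let eta_top i t : 0 <= t -> (t%:E < T)%E ->
  eta i n t = - (eps ^+ n)^-1 * (c 0%N * (eta i 0%N t - zeta t i 0) +
    \sum_(1 <= k < n) eps ^+ k * c k * eta i k t).
Proof.
move=> t0 tT; rewrite {1}/eta ltnNge r_le /= wv// mxE; congr (_ * _).
rewrite mxE; congr (_ + _).
  rewrite !mxE; congr (_ * (_ - _)); rewrite /eta r_gt0 /xi /= expr0.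
  by rewrite mulmx1 -row_mul [RHS]mxE [RHS]mxE.
rewrite summxE; apply: eq_bigr => k _; rewrite mxE; congr (_ * _).
by rewrite mxE.
Qed.

Let eta_signal P i k : signal_class T P ->
  P (fun t => (zeta t i 0 - ystar i 0) ^+ 2) -> (k < n)%N ->
  P (fun t => (eps ^+ k * eta i k t - (k == 0%N)%:R * ystar i 0) ^+ 2).
Proof.
move=> PP Pz; apply: (signal_integrator_chain PP eps0 Hhurwitz
  (zeta := fun t => zeta t i 0) (eta := eta i)) => //; first exact: sol_eta.
exact: eta_top.
Qed.

Lemma output_signal P i : signal_class T P ->
  P (fun t => (zeta t i 0 - ystar i 0) ^+ 2) ->
  P (fun t => ((C *m x t) i 0 - ystar i 0) ^+ 2).
Proof.
move=> PP /(eta_signal (k := 0) PP)/(_ (n_gt0 i)); congr P; apply/funext => t.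
rewrite expr0 !mul1r /eta r_gt0 /xi /= expr0.
by rewrite mulmx1 -row_mul [in LHS]mxE.
Qed.

Hypothesis Hminphase : hurwitz_mx Pi.

(** The chains bound [chib], the Hurwitz zero dynamics driven by [chib] bound [psi *m x], and [x] is
    a linear function of both. *)
Lemma agent_bounded :
  (forall i, is_bounded_signal T (fun t => (zeta t i 0 - ystar i 0) ^+ 2)) ->
  bounded_on T x.
Proof.
move=> zb; have BB := bounded_signal_class T.
have xib s : is_bounded_signal T (fun t => chib A C r (x t) s 0 ^+ 2).
  set i := tagnat.sig1 s; set k := tagnat.sig2 s : nat.
  have kr : (k < r i)%N by exact: ltn_ord.
  have [M etaM] := eta_signal BB (zb i) (leq_trans kr (r_le i)).
  pose y0 := (k == 0%N)%:R * ystar i 0.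
  (* Undoes the rescaling and the shift, using [(v + y0)^2 <= 2 (v^2 + y0^2)]. *)
  exists ((eps ^+ k)^-1 ^+ 2 * (2 * (M + y0 ^+ 2))) => t t0 tT.
  rewrite chibE -/i -/k.
  have -> : xi A C i k.+1 (x t) = (eps ^+ k)^-1 * ((eps ^+ k * eta i k t - y0) + y0).
    by rewrite subrK mulKf ?expf_neq0 ?gt_eqF// /eta kr.
  rewrite exprMn ler_wpM2l ?sqr_ge0//; have := etaM t t0 tT; rewrite -/y0.
  move: (_ - y0) => v vM; have := sqr_ge0 (v - y0).
  by rewrite -subr_ge0 => h; move: vM; rewrite -subr_ge0 => vM; nra.
have psib s : is_bounded_signal T (fun t => (psi *m x t) s 0 ^+ 2).
  apply: (signal_hurwitz BB Hminphase (x := fun t => psi *m x t)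
    (g := fun t => Psi *m chib A C r (x t))) => i; last exact: signal_mulmx BB xib.
  have := sol_mulmx psi (fun i j => sol_entry i j solx) i 0; congr solution_on.
  apply/funext => t; congr ((_ : 'cV_ _) i 0).
  by have [_ _ nf] := Hnf; have [] := nf (x t) (ut t).
have [V xV] := normal_form_inverse.
have xb j : is_bounded_signal T (fun t => x t j 0 ^+ 2).
  rewrite (_ : (fun t => _) = fun t =>
      (V *m col_mx (psi *m x t) (chib A C r (x t))) j 0 ^+ 2); last first.
    by apply/funext => t; rewrite -xV.
  apply: (signal_mulmx _ _ BB) => s; case: (split_ordP s) => s' ->.
    by move: (psib s'); congr is_bounded_signal; apply/funext => t; rewrite col_mxEu.
  by move: (xib s'); congr is_bounded_signal; apply/funext => t; rewrite col_mxEd.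
have [M HM] := choice xb.
exists (Num.sqrt (\sum_j M j)) => t t0 tT; rewrite /enorm dotE ler_wsqrtr//.
by apply: ler_sum => j _; rewrite big_ord1 -expr2 HM.
Qed.

End Agent.

(** * From squared entries to convergence of vectors, and conclusion *)

Lemma signal_sum (R : realType) (T : \bar R) (P : (R -> R) -> Prop)
    (I : Type) (s : seq I) (p : I -> R -> R) : signal_class T P ->
  (forall i, P (p i)) -> P (fun t => \sum_(i <- s) p i t).
Proof.
move=> PP Pp; elim: s => [|i s IH].
  rewrite (_ : (fun t => _) = (fun=> 0)); first exact: signal_0 PP.
  by apply/funext => t; rewrite big_nil.
rewrite (_ : (fun t => _) = (fun t => p i t + \sum_(i <- s) p i t)).
  exact: (signalD PP (Pp i) IH).
by apply/funext => t; rewrite big_cons.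
Qed.

Lemma enorm_sqE (R : realType) d (x : 'cV[R]_d) :
  enorm x ^+ 2 = \sum_k x k 0 ^+ 2.
Proof.
rewrite sqr_sqrtr dotE ?frob_ge0//; apply: eq_bigr => k _.
by rewrite big_ord1 -expr2.
Qed.

Lemma vanishing_converges (R : realType) d (y : R -> 'cV[R]_d) (l : 'cV[R]_d) :
  (forall k, is_vanishing_signal (fun t => (y t k 0 - l k 0) ^+ 2)) ->
  converges_to y l.
Proof.
move=> yl; have := signal_sum (index_enum 'I_d) (@vanishing_signal_class R) yl.
move=> H; apply/cvgrPdist_le => e e0.
have [s s0 Hs] := H (e ^+ 2) (exprn_gt0 _ e0).
near=> t; rewrite sub0r normrN ger0_norm ?sqrtr_ge0//.
rewrite -ler_sqr ?nnegrE ?sqrtr_ge0 ?(ltW e0)// enorm_sqE.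
under eq_bigr do rewrite mxE [X in _ + X]mxE.
by apply: Hs; near: t; apply: nbhs_pinfty_ge; exact: num_real.
Unshelve. all: by end_near. Qed.

Lemma exp_vanishing_converges (R : realType) d (y : R -> 'cV[R]_d)
    (l : 'cV[R]_d) :
  (forall k, is_exp_vanishing_signal (fun t => (y t k 0 - l k 0) ^+ 2)) ->
  converges_exponentially_to y l.
Proof.
move=> yl; have := signal_sum (index_enum 'I_d) (@exp_vanishing_signal_class R) yl.
(* The class concerns squares, so the rate of the norm is half of [b]. *)
move=> [b b0 [M HM]]; exists (b / 2); first by rewrite divr_gt0.
exists (Num.sqrt `|M|) => t t0.
rewrite -ler_sqr ?nnegrE ?sqrtr_ge0 ?mulr_ge0 ?sqrtr_ge0 ?expR_ge0//.
rewrite enorm_sqE exprMn sqr_sqrtr// expr2 -expRD.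
under eq_bigr do rewrite mxE [X in _ + X]mxE.
apply: le_trans (HM t t0) _.
rewrite [X in expR X](_ : _ = - (b / 2) * t + - (b / 2) * t); last by field.
by rewrite ler_wpM2r ?expR_ge0 ?ler_norm.
Qed.

(** Signals of non-neighbors enter the sums with weight 0. *)
Lemma consensus_control_distributed (R : realType) (N kappa m : nat)
    (A : 'M[R]_kappa) (B : 'M[R]_(kappa, m)) (C : 'M[R]_(m, kappa))
    (r : 'I_m -> nat) (psi : 'M[R]_(kappa - \sum_i r i, kappa))
    (Upsilon : 'M[R]_(m, kappa - \sum_i r i)) (S : 'M[R]_(m, \sum_i r i))
    (a : 'M[R]_N) (n : nat) (c : nat -> R) (eps : R) :
  undirected_graph a ->
  distributed a (consensus_control A B C psi Upsilon S a n c eps).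
Proof.
move=> [_ _ a0] g i T x u e e' ee' [w [sz sl sw wv uE]].
have ei : e i = e' i by apply: ee'; left.
have sumE (p : 'cV[R]_m * 'cV[R]_m -> 'cV[R]_m) t :
    \sum_j a i j *: (p (e i t) - p (e j t)) = \sum_j a i j *: (p (e i t) - p (e' j t)).
  apply: eq_bigr => j _; have := a0 i j.
  rewrite le_eqVlt => /orP[/eqP <-|aij]; first by rewrite !scale0r.
  by rewrite (ee' j)//; right.
exists w => /=; rewrite -ei; split=> //.
- move: sz; congr solution_on; apply/funext => t.
  by rewrite (sumE snd).
- move: sl; congr solution_on; apply/funext => t.
  by rewrite (sumE fst).
Qed.

Theorem theorem2 (R : realType) (N kappa m : nat)
    (A : 'M[R]_kappa) (B : 'M[R]_(kappa, m)) (C : 'M[R]_(m, kappa))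
    (r : 'I_m -> nat)
    (psi : 'M[R]_(kappa - \sum_i r i, kappa))
    (Pi : 'M[R]_(kappa - \sum_i r i))
    (Psi : 'M[R]_(kappa - \sum_i r i, \sum_i r i))
    (Upsilon : 'M[R]_(m, kappa - \sum_i r i))
    (S : 'M[R]_(m, \sum_i r i))
    (a : 'M[R]_N) (f : 'I_N -> 'cV[R]_m -> R) (ystar : 'cV[R]_m)
    (n : nat) (c : nat -> R)
    (Hrel : vector_relative_degree A B C r)
    (Hnf : normal_form A B C psi Pi Psi Upsilon S)
    (Hminphase : hurwitz_mx Pi)
    (Hundir : undirected_graph a)
    (Hconn : connected_graph a)
    (Hdiff : forall i y, differentiable (f i : 'cV[R]_m -> R^o) y)
    (Hconvex : forall i, strictly_convex (f i))
    (Hmin : minimizer (fun y => \sum_i f i y) ystar)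
    (Hn : n = (\max_i r i)%N)
    (Hhurwitz : hurwitz_poly ('X^n + \poly_(k < n) c k)) :
  forall eps : R, 0 < eps ->
  let K := consensus_control A B C psi Upsilon S a n c eps in
  solves_optimal_output_consensus A B C a f ystar K /\
  ((exists omega theta : R,
     [/\ 0 < omega, 0 < theta,
         forall i, strongly_convex omega (f i) &
         forall i, lipschitz_grad theta (f i)]) ->
   forall x : 'I_N -> R -> 'cV[R]_kappa,
     closed_loop A B f K +oo%E x ->
     forall i, converges_exponentially_to (fun t => C *m x i t) ystar).
Proof.
move=> eps eps0 K; split; first split.
- exact: consensus_control_distributed.
- move=> T x T0 [u [e He]].
  (* The exchanged signals form an autonomous subsystem, studied first; each agent is then a stable
     filter driven by its own [z i]. *)
  pose z i t := (e i t).1; pose lam i t := (e i t).2.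
  have solz i : solution_on T (z i) (fun t =>
      - grad (f i) (z i t) - \sum_j a i j *: (lam i t - lam j t)).
    by have [_ [w []]] := He i.
  have sollam i : solution_on T (lam i) (fun t =>
      \sum_j a i j *: (z i t - z j t)).
    by have [_ [w []]] := He i.
  split=> [i|Too i]; have [sx [w [_ _ sw wv uE]]] := He i.
    apply: (agent_bounded Hnf Hrel Hn Hhurwitz eps0 sx sw wv uE Hminphase) => k.
    exact: (saddle_dynamics_bounded Hundir Hconn Hdiff Hconvex Hmin solz sollam).
  apply: vanishing_converges => k.
  apply: (output_signal (P := @is_vanishing_signal R)
    Hnf Hrel Hn Hhurwitz eps0 sx sw wv uE).
    by rewrite Too; exact: vanishing_signal_class.
  exact: (saddle_dynamics_vanishing Hundir Hconn Hdiff Hconvex Hmin solz sollam).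
- move=> [omega [theta [om0 _ sc lg]]] x [u [e He]] i.
  pose z i t := (e i t).1; pose lam i t := (e i t).2.
  have solz j : solution_on +oo%E (z j) (fun t =>
      - grad (f j) (z j t) - \sum_l a j l *: (lam j t - lam l t)).
    by have [_ [w []]] := He j.
  have sollam j : solution_on +oo%E (lam j) (fun t =>
      \sum_l a j l *: (z j t - z l t)).
    by have [_ [w []]] := He j.
  have [sx [w [_ _ sw wv uE]]] := He i.
  apply: exp_vanishing_converges => k.
  apply: (output_signal (P := @is_exp_vanishing_signal R)
    Hnf Hrel Hn Hhurwitz eps0 sx sw wv uE).
    exact: exp_vanishing_signal_class.
  exact: (saddle_dynamics_exp_vanishing Hundir Hconn Hdiff Hmin
    solz sollam i k erefl om0 sc lg).
Qed.
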